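(* Let $b>0$, $\tau>0$, $C>0$, let $q\in C[-b,b]$ be complex valued, and let $f$, $\alpha=f'(0)$ and the formal powers $\{\varphi_k\}_{k=0}^\infty$ associated with $f$ be as described in the context. Let $F,G\in H(b,\tau,C,0)$ (the Holmgren class defined in the context), and let $u(x,t)$ be a (classical) solution of the noncharacteristic Cauchy problem $$u_{xx}(x,t)-q(x)u(x,t)=u_t(x,t),\qquad -b<x<b,\ |t|<\tau,$$ $$u(0,t)=F(t),\qquad u_x(0,t)=G(t),\qquad |t|<\tau.$$ Then for every $r$ with $0<r<b$ the series $$\sum_{j=0}^{\infty}\left[\frac{F^{(j)}(t)}{(2j)!}\left(\varphi_{2j}(x)-\frac{\alpha}{2j+1}\varphi_{2j+1}(x)\right)+\frac{G^{(j)}(t)}{(2j+1)!}\varphi_{2j+1}(x)\right]$$ converges absolutely and uniformly on $\{(x,t): |x|\le r,\ |t|<\tau\}$ to the solution $u(x,t)$.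
   Context: Functions are complex valued. A (classical) solution $u$ is one for which $u_{xx}$ and $u_t$ exist and are continuous and the equation holds pointwise. The function $f$ is a nonvanishing (complex valued) solution of $f''-q(x)f=0$ on $(-b,b)$ with $f(0)=1$ and $f'(0)=\alpha$, where $\alpha\in\mathbb{C}$. Recurrent integrals: define $X^{(0)}\equiv 1$, $\tilde X^{(0)}\equiv 1$ and, for $n\in\mathbb{N}$ and $x\in(-b,b)$, $$X^{(n)}(x)=n\int_0^x X^{(n-1)}(s)\,\bigl(f^2(s)\bigr)^{(-1)^n}ds,\qquad \tilde X^{(n)}(x)=n\int_0^x \tilde X^{(n-1)}(s)\,\bigl(f^2(s)\bigr)^{(-1)^{n-1}}ds.$$ Formal powers associated with $f$: $\varphi_k(x)=f(x)X^{(k)}(x)$ if $k$ is odd, and $\varphi_k(x)=f(x)\tilde X^{(k)}(x)$ if $k$ is even, $k=0,1,2,\ldots$ Holmgren class: for positive constants $\gamma_1,\gamma_2,C_1$ and $t_0\in\mathbb{R}$, $H(\gamma_1,\gamma_2,C_1,t_0)$ is the set of infinitely differentiable functions $v$ defined on $|t-t_0|<\gamma_2$ satisfying $|v^{(j)}(t)|\le C_1\gamma_1^{-2j}(2j)!$ for all $j=0,1,\ldots$ and all $t$ with $|t-t_0|<\gamma_2$. *)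

(* Defs.v *)
From Stdlib Require Import Reals Arith Factorial.
From Coquelicot Require Import Coquelicot.

Open Scope R_scope.

(** Derivatives of complex valued functions of a real variable.  Like
    Coquelicot's [Derive], [CDerive] is total and is meaningful only where
    [Cderivable] holds (see [is_derive_CDerive]). *)

Definition Cderivable (g : R -> C) (x : R) : Prop :=
  ex_derive (K := R_AbsRing) (V := C_R_NormedModule) g x.

Definition CDerive (g : R -> C) (x : R) : C :=
  (Derive (fun y => Re (g y)) x, Derive (fun y => Im (g y)) x).

Fixpoint CDerive_n (g : R -> C) (n : nat) (x : R) : C :=
  match n with
  | O => g x
  | S m => CDerive (CDerive_n g m) x
  end.

Lemma is_derive_CDerive (g : R -> C) (x : R) (l : C) :
  is_derive (K := R_AbsRing) (V := C_R_NormedModule) g x l -> CDerive g x = l.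
Proof.
  intros H; destruct l as [a c]; unfold CDerive; f_equal; apply is_derive_unique.
  - exact (filterdiff_comp' (K := R_AbsRing) (V := C_R_NormedModule) g _ x _ _ H
             (filterdiff_linear _ (is_linear_fst (K := R_AbsRing)
                (U := R_NormedModule) (V := R_NormedModule)))).
  - exact (filterdiff_comp' (K := R_AbsRing) (V := C_R_NormedModule) g _ x _ _ H
             (filterdiff_linear _ (is_linear_snd (K := R_AbsRing)
                (U := R_NormedModule) (V := R_NormedModule)))).
Qed.

(** [f] is a nonvanishing solution of [f'' - q f = 0] on [(-b, b)]. *)
Record nonvanishing_solution (b : R) (q f : R -> C) : Prop := {
  nvs_neq0 : forall x, -b < x < b -> f x <> 0%C;
  nvs_d1 : forall x, -b < x < b -> Cderivable f x;
  nvs_d2 : forall x, -b < x < b -> Cderivable (CDerive f) x;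
  nvs_eq : forall x, -b < x < b -> (CDerive_n f 2 x - q x * f x = 0)%C
}.

(** [z] raised to the power [(-1)^n]. *)
Definition Cpow_sign (z : C) (n : nat) : C := if Nat.even n then z else (/ z)%C.

Definition CRInt (g : R -> C) (a b : R) : C :=
  RInt (V := C_R_CompleteNormedModule) g a b.

(** Recurrent integrals [X^(n)] and [~X^(n)]; in [Xtint] the exponent
    [(-1)^(n-1)] is [(-1)^m] since [n = S m]. *)
Fixpoint Xint (f : R -> C) (n : nat) (x : R) : C :=
  match n with
  | O => 1%C
  | S m => (INR (S m) *
            CRInt (fun s => (Xint f m s * Cpow_sign (f s ^ 2) (S m))%C) 0 x)%C
  end.

Fixpoint Xtint (f : R -> C) (n : nat) (x : R) : C :=
  match n with
  | O => 1%C
  | S m => (INR (S m) *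
            CRInt (fun s => (Xtint f m s * Cpow_sign (f s ^ 2) m)%C) 0 x)%C
  end.

Definition formal_power (f : R -> C) (k : nat) (x : R) : C :=
  (f x * (if Nat.odd k then Xint f k x else Xtint f k x))%C.

(** Holmgren class [H(g1, g2, C1, t0)]; only the values of [v] on
    [|t - t0| < g2] matter. *)
Record Holmgren (g1 g2 C1 t0 : R) (v : R -> C) : Prop := {
  Holmgren_smooth : forall (j : nat) (t : R),
    Rabs (t - t0) < g2 -> Cderivable (CDerive_n v j) t;
  Holmgren_bound : forall (j : nat) (t : R),
    Rabs (t - t0) < g2 ->
    Cmod (CDerive_n v j t) <= C1 * / g1 ^ (2 * j) * INR (fact (2 * j))
}.

(** Partial derivatives of [u(x,t)]. *)
Definition d_x (u : R -> R -> C) (x t : R) : C := CDerive (fun y => u y t) x.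
Definition d_xx (u : R -> R -> C) (x t : R) : C := d_x (d_x u) x t.
Definition d_t (u : R -> R -> C) (x t : R) : C := CDerive (fun s => u x s) t.

(** Joint continuity in [(x,t)]. *)
Definition continuous2 (v : R -> R -> C) (x t : R) : Prop :=
  continuous (T := prod_UniformSpace R_UniformSpace R_UniformSpace)
    (U := C_UniformSpace) (fun p => v (fst p) (snd p)) (x, t).

(** Classical solution of the noncharacteristic Cauchy problem on
    [(-b, b) x (-tau, tau)] with data prescribed on [x = 0]. *)
Record classical_Cauchy_solution
    (b tau : R) (q F G : R -> C) (u : R -> R -> C) : Prop := {
  ccs_dx : forall x t, -b < x < b -> Rabs t < tau ->
    Cderivable (fun y => u y t) x;
  ccs_dxx : forall x t, -b < x < b -> Rabs t < tau ->
    Cderivable (fun y => d_x u y t) x;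
  ccs_dt : forall x t, -b < x < b -> Rabs t < tau ->
    Cderivable (fun s => u x s) t;
  ccs_dxx_cont : forall x t, -b < x < b -> Rabs t < tau ->
    continuous2 (d_xx u) x t;
  ccs_dt_cont : forall x t, -b < x < b -> Rabs t < tau ->
    continuous2 (d_t u) x t;
  ccs_eq : forall x t, -b < x < b -> Rabs t < tau ->
    (d_xx u x t - q x * u x t = d_t u x t)%C;
  ccs_data0 : forall t, Rabs t < tau -> u 0 t = F t;
  ccs_data1 : forall t, Rabs t < tau -> d_x u 0 t = G t
}.

Definition series_term (f : R -> C) (alpha : C) (F G : R -> C)
    (j : nat) (x t : R) : C :=
  (CDerive_n F j t / INR (fact (2 * j)) *
     (formal_power f (2 * j) x
      - alpha / INR (2 * j + 1) * formal_power f (2 * j + 1) x)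
   + CDerive_n G j t / INR (fact (2 * j + 1)) * formal_power f (2 * j + 1) x)%C.

(** Absolute (pointwise) and uniform convergence on [D] of a series of complex
    valued functions of [(x,t)] to the sum [s]. *)
Definition converges_absolutely_on (D : R -> R -> Prop)
    (a : nat -> R -> R -> C) : Prop :=
  forall x t, D x t -> ex_series (fun j => Cmod (a j x t)).

Definition converges_uniformly_on (D : R -> R -> Prop)
    (a : nat -> R -> R -> C) (s : R -> R -> C) : Prop :=
  forall eps : R, 0 < eps ->
  exists N : nat, forall (n : nat) (x t : R), (N <= n)%nat -> D x t ->
    Cmod (sum_n (G := C_AbelianMonoid) (fun j => a j x t) n - s x t)%C < eps.

(* Main.v *)
Require Import Defs.
From Stdlib Require Import Reals Factorial Lra Lia.
From Coquelicot Require Import Coquelicot.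

(** Write [L y = y'' - q y].  The normalized powers [e_k = phi_k / k!] satisfy
    [L e_k = e_(k-2)], and a comparison of second-order equations gives
    [|phi_k x| <= |x|^k exp (c |x|)]; with the Holmgren bounds this makes the
    series dominated by a geometric one of ratio [(r / b)^2].

    To identify the sum, let [S_i] be the [i]-th partial sum and test [u - S_i]
    in [t] against derivatives of the bump [psi = (w^2 - (t - t0)^2)^n]:
    [W_i x = int (u - S_i)(x, t) psi^(n-i)(t) dt].  Since [L u = u_t] and
    [L S_(i+1) = (S_i)_t], integration by parts gives [L W_(i+1) = - W_i] with
    zero Cauchy data at [x = 0], so the same comparison yields
    [|W_n x| <= sup |W_0| |x|^(2n) exp (c |x|) / (2n)!].  As [psi^(n)] is at most
    [4^n n!] while the mean of [psi] is only exponentially small in [n], the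
    weighted mean of [u - S_n] over a fixed small interval around [t0] tends to
    [0], whence [u = lim S_n] at [(x, t0)]. *)

(** * Derivatives of complex valued functions *)

(** The obstacle is that [u] has a single derivative in [t], so [L] cannot be applied to it
    repeatedly. Pairing with a weight in [t] throws all further derivatives onto the weight, and a
    count of factorials decides whether the argument closes. The [2n]-fold integration in [x] gains
    [(2n)!]; the [n] derivatives of the weight cost [n!] up to a geometric factor; dividing by the
    integral of the weight costs one more geometric factor. What remains is [B^n / n!], which tends
    to [0] however large [B] is, so [w] may be as small as continuity at [t0] demands.

    The weight is a polynomial that changes with [n]: it vanishes at the endpoints to the order that
    [n] integrations by parts require, and its derivatives still obey a bound of the form geometric
    times factorial. The Holmgren bounds enter only through the geometric majorant of the series;
    that majorant is also what allows [S_n] to be replaced by a fixed [S_N] before [n] goes to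
    infinity. *)

Notation is_cderive := (is_derive (K := R_AbsRing) (V := C_R_NormedModule)).

(** Bridge to real calculus: products, inverses, mean values and integrals are all treated on the
    two components. The converse rebuilds [g] by composing its components with the linear pairing
    map. *)
Lemma is_cderive_iff (g : R -> C) (x : R) (l : C) :
  is_cderive g x l <->
  is_derive (fun y => Re (g y)) x (Re l) /\ is_derive (fun y => Im (g y)) x (Im l).
Proof.
  split.
  - intros H; split.
    + exact (filterdiff_comp' (K := R_AbsRing) (V := C_R_NormedModule) g _ x _ _ H
             (filterdiff_linear _ (is_linear_fst (K := R_AbsRing)
                (U := R_NormedModule) (V := R_NormedModule)))).
    + exact (filterdiff_comp' (K := R_AbsRing) (V := C_R_NormedModule) g _ x _ _ H
             (filterdiff_linear _ (is_linear_snd (K := R_AbsRing)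
                (U := R_NormedModule) (V := R_NormedModule)))).
  - intros [H1 H2].
    apply (is_derive_ext (K := R_AbsRing) (V := C_R_NormedModule)
             (fun y => ((Re (g y), Im (g y)) : C))).
    { intros t; destruct (g t); reflexivity. }
    unfold is_derive.
    apply (filterdiff_ext_lin (K := R_AbsRing) (V := C_R_NormedModule) _
             (fun y : R => (scal (K := R_AbsRing) (V := R_NormedModule) y (Re l),
                            scal (K := R_AbsRing) (V := R_NormedModule) y (Im l)))).
    2:{ intros y; destruct l; reflexivity. }
    apply (filterdiff_comp_2 (K := R_AbsRing) (U := R_NormedModule) (V := R_NormedModule)
       (W := C_R_NormedModule)
       (fun y => Re (g y)) (fun y => Im (g y)) (fun a c => (a, c)) _ _ (fun a c => (a, c))
       H1 H2).
    apply (filterdiff_ext (K := R_AbsRing) (V := C_R_NormedModule) (fun p => p)).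
    { intros [a c]; reflexivity. }
    apply (filterdiff_ext_lin (K := R_AbsRing) (V := C_R_NormedModule) _ (fun p => p)).
    2:{ intros [a c]; reflexivity. }
    apply filterdiff_id.
Qed.

Lemma is_cderive_CDerive (g : R -> C) (x : R) :
  Cderivable g x -> is_cderive g x (CDerive g x).
Proof.
  intros [l H]. now rewrite (is_derive_CDerive g x l H).
Qed.

Lemma is_cderive_eq (g : R -> C) (x : R) (l l' : C) :
  is_cderive g x l -> l = l' -> is_cderive g x l'.
Proof. now intros H <-. Qed.

Lemma is_cderive_const (a : C) (x : R) : is_cderive (fun _ => a) x (RtoC 0).
Proof. exact (is_derive_const (K := R_AbsRing) (V := C_R_NormedModule) a x). Qed.

Lemma is_cderive_plus (g h : R -> C) (x : R) (l m : C) :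
  is_cderive g x l -> is_cderive h x m ->
  is_cderive (fun y => g y + h y)%C x (Cplus l m).
Proof. apply (is_derive_plus (K := R_AbsRing) (V := C_R_NormedModule)). Qed.

Lemma is_cderive_minus (g h : R -> C) (x : R) (l m : C) :
  is_cderive g x l -> is_cderive h x m ->
  is_cderive (fun y => g y - h y)%C x (Cminus l m).
Proof. apply (is_derive_minus (K := R_AbsRing) (V := C_R_NormedModule)). Qed.

Lemma is_cderive_mult (g h : R -> C) (x : R) (l m : C) :
  is_cderive g x l -> is_cderive h x m ->
  is_cderive (fun y => g y * h y)%C x (Cplus (Cmult l (h x)) (Cmult (g x) m)).
Proof.
  rewrite !is_cderive_iff; intros [Hg1 Hg2] [Hh1 Hh2]; cbn; split.
  - eapply is_derive_ext; [intros t; reflexivity|].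
    evar_last.
    { apply (is_derive_minus (K := R_AbsRing) (V := R_NormedModule)
        (fun y => Re (g y) * Re (h y)) (fun y => Im (g y) * Im (h y))).
      - apply (is_derive_mult (K := R_AbsRing)); [exact Hg1 | exact Hh1 | intros; apply Rmult_comm].
      - apply (is_derive_mult (K := R_AbsRing)); [exact Hg2 | exact Hh2 | intros; apply Rmult_comm]. }
    unfold minus, plus, opp, mult, Re, Im; cbn; ring.
  - evar_last.
    { apply (is_derive_plus (K := R_AbsRing) (V := R_NormedModule)
        (fun y => Re (g y) * Im (h y)) (fun y => Im (g y) * Re (h y))).
      - apply (is_derive_mult (K := R_AbsRing)); [exact Hg1 | exact Hh2 | intros; apply Rmult_comm].
      - apply (is_derive_mult (K := R_AbsRing)); [exact Hg2 | exact Hh1 | intros; apply Rmult_comm]. }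
    unfold plus, mult, Re, Im; cbn; ring.
Qed.

Lemma is_derive_eq (g : R -> R) (x l l' : R) :
  is_derive g x l -> l = l' -> is_derive g x l'.
Proof. now intros H <-. Qed.

Lemma is_cderive_inv (g : R -> C) (x : R) (l : C) :
  is_cderive g x l -> g x <> 0%C ->
  is_cderive (fun y => / g y)%C x (Cdiv (Copp l) (Cmult (g x) (g x))).
Proof.
  rewrite !is_cderive_iff; intros [H1 H2] H0.
  assert (Hn : Re (g x) * Re (g x) + Im (g x) * Im (g x) <> 0).
  { intros E; apply H0; destruct (g x) as [p r]; cbn in *.
    assert (p = 0) by nra; assert (r = 0) by nra; now subst. }
  assert (Hs : is_derive (fun t => Re (g t) * Re (g t) + Im (g t) * Im (g t)) x
                (2 * Re l * Re (g x) + 2 * Im l * Im (g x))).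
  { eapply is_derive_eq.
    - apply (is_derive_plus (K := R_AbsRing) (V := R_NormedModule));
        apply Derive.is_derive_mult; eassumption.
    - unfold plus; cbn; ring. }
  assert (Hi := is_derive_inv _ _ _ Hs Hn).
  split.
  - apply (is_derive_ext (fun t => Re (g t) * / (Re (g t) * Re (g t) + Im (g t) * Im (g t)))).
    { intros t; unfold Re, Im; cbn; unfold Rdiv; do 2 f_equal; ring. }
    eapply is_derive_eq; [apply Derive.is_derive_mult; eassumption|].
    unfold Re, Im in *; cbn in *. destruct (g x) as [p r], l as [l1 l2]; cbn in *.
    field; split; [|exact Hn].
    replace (_ + _) with ((p * p + r * r) * (p * p + r * r)) by ring.
    now apply Rmult_integral_contrapositive.
  - apply (is_derive_ext (fun t => - Im (g t) * / (Re (g t) * Re (g t) + Im (g t) * Im (g t)))).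
    { intros t; unfold Re, Im; cbn; unfold Rdiv; do 2 f_equal; ring. }
    eapply is_derive_eq.
    { apply Derive.is_derive_mult; [|eassumption].
      apply (is_derive_opp (K := R_AbsRing) (V := R_NormedModule)); eassumption. }
    unfold Re, Im in *; cbn in *. destruct (g x) as [p r], l as [l1 l2]; cbn in *.
    unfold opp; cbn.
    field; split; [|exact Hn].
    replace (_ + _) with ((p * p + r * r) * (p * p + r * r)) by ring.
    now apply Rmult_integral_contrapositive.
Qed.

Lemma is_cderive_continuous (g : R -> C) (x : R) (l : C) :
  is_cderive g x l -> continuous (U := C_UniformSpace) g x.
Proof.
  intros H. apply (ex_derive_continuous (K := R_AbsRing) (V := C_R_NormedModule)).
  now exists l.
Qed.

Lemma is_cderive_opp (g : R -> C) (x : R) (l : C) :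
  is_cderive g x l -> is_cderive (fun y => Copp (g y)) x (Copp l).
Proof. apply (is_derive_opp (K := R_AbsRing) (V := C_R_NormedModule)). Qed.

(** * Comparison for second-order equations *)

Lemma is_derive_nonneg_le (f df : R -> R) (X : R) :
  (forall s, 0 <= s <= X -> is_derive f s (df s)) ->
  (forall s, 0 <= s <= X -> 0 <= df s) ->
  forall s, 0 <= s <= X -> f 0 <= f s.
Proof.
  intros Hd Hp s Hs.
  destruct (MVT_gen f 0 s df) as [c [Hc E]].
  - intros x; rewrite Rmin_left, Rmax_right by lra; intros; apply Hd; lra.
  - intros x; rewrite Rmin_left, Rmax_right by lra; intros.
    apply continuity_pt_filterlim.
    apply (ex_derive_continuous (K := R_AbsRing) (V := R_NormedModule)).
    exists (df x); apply Hd; lra.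
  - rewrite Rmin_left, Rmax_right in Hc by lra.
    assert (0 <= df c) by (apply Hp; lra). nra.
Qed.

(** Monotonicity is applied twice to [P - y]: first to its derivative, then to the difference
    itself, so only the Cauchy data at [0] have to be compared. *)
Lemma second_derivative_le (y y1 y2 P P1 P2 : R -> R) (X : R) :
  (forall s, 0 <= s <= X -> is_derive y s (y1 s)) ->
  (forall s, 0 <= s <= X -> is_derive y1 s (y2 s)) ->
  (forall s, 0 <= s <= X -> is_derive P s (P1 s)) ->
  (forall s, 0 <= s <= X -> is_derive P1 s (P2 s)) ->
  (forall s, 0 <= s <= X -> y2 s <= P2 s) ->
  y 0 <= P 0 -> y1 0 <= P1 0 ->
  forall s, 0 <= s <= X -> y s <= P s.
Proof.
  intros Hy Hy1 HP HP1 H2 H0 H1 s Hs.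
  assert (A : forall s, 0 <= s <= X -> P1 0 - y1 0 <= P1 s - y1 s).
  { apply (is_derive_nonneg_le (fun s => P1 s - y1 s) (fun s => P2 s - y2 s)).
    - intros t Ht; apply (is_derive_minus (K := R_AbsRing) (V := R_NormedModule)); auto.
    - intros t Ht; specialize (H2 t Ht); lra. }
  enough (P 0 - y 0 <= P s - y s) by lra.
  apply (is_derive_nonneg_le (fun s => P s - y s) (fun s => P1 s - y1 s) X); auto.
  - intros t Ht; apply (is_derive_minus (K := R_AbsRing) (V := R_NormedModule)); auto.
  - intros t Ht; specialize (A t Ht); lra.
Qed.

Lemma Re_le_Cmod (z : C) : Re z <= Cmod z.
Proof. generalize (re_le_Cmod z) (Rle_abs (Re z)); lra. Qed.

(** The complex case reduces to the real one by projecting on the direction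
    of [y s]. *)
Lemma Cmod_second_derivative_le (y y1 y2 : R -> C) (P P1 P2 : R -> R) (X : R) :
  (forall s, 0 <= s <= X -> is_cderive y s (y1 s)) ->
  (forall s, 0 <= s <= X -> is_cderive y1 s (y2 s)) ->
  (forall s, 0 <= s <= X -> is_derive P s (P1 s)) ->
  (forall s, 0 <= s <= X -> is_derive P1 s (P2 s)) ->
  (forall s, 0 <= s <= X -> Cmod (y2 s) <= P2 s) ->
  Cmod (y 0) <= P 0 -> Cmod (y1 0) <= P1 0 ->
  forall s, 0 <= s <= X -> Cmod (y s) <= P s.
Proof.
  intros Hy Hy1 HP HP1 H2 H0 H1 s Hs.
  assert (A : forall w : C, Cmod w = 1 -> Re (w * y s) <= P s).
  { intros w Hw.
    assert (B : forall z, Re (w * z) <= Cmod z).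
    { intros z. eapply Rle_trans; [apply Re_le_Cmod|]. rewrite Cmod_mult, Hw; lra. }
    assert (D : forall (g g1 : R -> C) t, is_cderive g t (g1 t) ->
              is_derive (fun s => Re (w * g s)) t (Re (w * g1 t))).
    { intros g g1 t Hg.
      apply (is_cderive_iff (fun s => w * g s)%C t (w * g1 t)%C).
      eapply is_cderive_eq.
      - apply is_cderive_mult; [apply is_cderive_const | exact Hg].
      - cbn beta. ring. }
    apply (second_derivative_le (fun s => Re (w * y s)) (fun s => Re (w * y1 s)) (fun s => Re (w * y2 s)) P P1 P2 X);
      auto; try (eapply Rle_trans; [apply B | assumption]).
    intros t Ht; eapply Rle_trans; [apply B | auto]. }
  (* If [y s = 0] it has no direction, and [w = 1] already yields [0 <= P s]. Otherwise
     [w = |y s| / y s] makes the projection at [s] equal to the modulus. *)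
  destruct (Req_dec (Cmod (y s)) 0) as [E|E].
  - rewrite E. specialize (A 1%C Cmod_1). rewrite (Cmod_eq_0 _ E) in A.
    cbn in A; lra.
  - assert (E' : y s <> 0%C) by (intros F; apply E; rewrite F; apply Cmod_0).
    assert (Ec : RtoC (Cmod (y s)) <> 0%C) by (intros F; apply E; now inversion F).
    specialize (A (Cmod (y s) / y s)%C).
    rewrite Cmod_div, Cmod_R, Rabs_pos_eq in A by auto using Cmod_ge_0.
    replace (Cmod (y s) / y s * y s)%C with (RtoC (Cmod (y s))) in A by (now field).
    apply A; now field.
Qed.

Lemma is_derive_pow_div_fact (n : nat) (s : R) :
  is_derive (fun s => s ^ S n / INR (fact (S n))) s (s ^ n / INR (fact n)).
Proof.
  auto_derive; [exact I|].
  change (fact n + n * fact n)%nat with (S n * fact n)%nat; rewrite mult_INR.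
  change (match n with 0%nat => 1 | S _ => INR n + 1 end) with (INR (S n)).
  field; split; [apply INR_fact_neq_0 | apply not_0_INR; lia].
Qed.

Lemma continuous_bounded (h : R -> R) (a c : R) :
  (forall x, a <= x <= c -> continuous h x) ->
  exists M, 0 <= M /\ forall x, a <= x <= c -> h x <= M.
Proof.
  intros H. destruct (Rle_dec a c) as [L|L].
  - destruct (continuity_ab_maj h a c L) as [x0 [Hx _]].
    + intros x Hx; apply continuity_pt_filterlim; now apply H.
    + exists (Rmax 0 (h x0)); split; [apply Rmax_l|].
      intros x Hx'; eapply Rle_trans; [now apply Hx | apply Rmax_r].
  - exists 0; split; [lra|]; intros; lra.
Qed.

Lemma continuous_Cmod_comp (g : R -> C) (x : R) :
  continuous (U := C_UniformSpace) g x -> continuous (fun s => Cmod (g s)) x.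
Proof.
  intros H.
  apply (continuous_ext (fun s => norm (K := R_AbsRing) (V := C_R_NormedModule) (g s))).
  { intros s. unfold Cmod; rewrite <- (pow2_abs (fst (g s))), <- (pow2_abs (snd (g s))).
    reflexivity. }
  apply (continuous_comp (V := C_R_NormedModule) g (norm (K := R_AbsRing))); [exact H|].
  exact (filterlim_norm (K := R_AbsRing) (V := C_R_NormedModule) (g x)).
Qed.

(** Iterating the comparison starting from a crude bound [D] gives
    [|y s| <= P s + D (Q s^2)^m / (2m)!] for every [m]. *)
Lemma ode_majorant (y y1 q g : R -> C) (P P1 P2 G : R -> R) (Q X : R) :
  0 <= Q ->
  (forall s, 0 <= s <= X -> is_cderive y s (y1 s)) ->
  (forall s, 0 <= s <= X -> is_cderive y1 s (Cplus (Cmult (q s) (y s)) (g s))) ->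
  (forall s, 0 <= s <= X -> is_derive P s (P1 s)) ->
  (forall s, 0 <= s <= X -> is_derive P1 s (P2 s)) ->
  (forall s, 0 <= s <= X -> Cmod (q s) <= Q) ->
  (forall s, 0 <= s <= X -> Cmod (g s) <= G s) ->
  (forall s, 0 <= s <= X -> 0 <= P s) ->
  (forall s, 0 <= s <= X -> Q * P s + G s <= P2 s) ->
  Cmod (y 0) <= P 0 -> Cmod (y1 0) <= P1 0 ->
  forall s, 0 <= s <= X -> Cmod (y s) <= P s.
Proof.
  intros HQ Hy Hy1 HP HP1 Hq Hg HP0 H2 H0 H1.
  destruct (continuous_bounded (fun s => Cmod (y s)) 0 X) as [D [HD Hyb]].
  { intros s Hs; apply continuous_Cmod_comp; eapply is_cderive_continuous; now apply Hy. }
  set (E := fun (n : nat) (s : R) => s ^ n / INR (fact n)).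
  assert (IT : forall m s, 0 <= s <= X -> Cmod (y s) <= P s + D * Q ^ m * E (2 * m)%nat s).
  { induction m as [|m IH]; intros s Hs.
    { unfold E; cbn -[fact]. specialize (Hyb s Hs). specialize (HP0 s Hs).
      replace (fact 0) with 1%nat by reflexivity; cbn. lra. }
    replace (2 * S m)%nat with (S (S (2 * m))) by lia.
    apply (Cmod_second_derivative_le y y1 (fun s => q s * y s + g s)%C
       (fun s => P s + D * Q ^ S m * E (S (S (2 * m))) s)
       (fun s => P1 s + D * Q ^ S m * E (S (2 * m)) s)
       (fun s => P2 s + D * Q ^ S m * E (2 * m)%nat s) X); auto.
    - intros t Ht. apply (is_derive_plus (K := R_AbsRing) (V := R_NormedModule)); [auto|].
      apply (is_derive_scal), is_derive_pow_div_fact.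
    - intros t Ht. apply (is_derive_plus (K := R_AbsRing) (V := R_NormedModule)); [auto|].
      apply (is_derive_scal), is_derive_pow_div_fact.
    - intros t Ht. eapply Rle_trans; [apply Cmod_triangle|]. rewrite Cmod_mult.
      specialize (IH t Ht). specialize (H2 t Ht). specialize (Hg t Ht). specialize (Hq t Ht).
      assert (Cmod (q t) * Cmod (y t) <= Q * (P t + D * Q ^ m * E (2 * m)%nat t)).
      { apply Rmult_le_compat; auto using Cmod_ge_0. }
      replace (D * Q ^ S m * E (2 * m)%nat t) with (Q * (D * Q ^ m * E (2 * m)%nat t)) by (cbn; ring).
      lra.
    - unfold E; cbn [pow]; unfold Rdiv; rewrite !Rmult_0_l, Rmult_0_r; lra.
    - unfold E; cbn [pow]; unfold Rdiv; rewrite !Rmult_0_l, Rmult_0_r; lra. }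
  intros s Hs.
  apply Rle_plus_epsilon; intros eps Heps.
  (* This base satisfies [Q^N s^(2N) <= A^(2N)] without a square root of [Q]: since [Q + 1 >= 1],
     the power [(Q + 1)^N] is at most [(Q + 1)^(2N)]. *)
  set (A := (Q + 1) * (s + 1)).
  assert (HA : 0 <= A * A) by apply Rle_0_sqr.
  (* The crude bound [D] may be zero, hence the denominator [D + 1]. *)
  destruct (cv_speed_pow_fact A (eps / (D + 1))) as [N HN].
  { apply Rdiv_lt_0_compat; lra. }
  specialize (HN (2 * N)%nat ltac:(lia)).
  unfold Rdist in HN; rewrite Rminus_0_r in HN.
  specialize (IT N s Hs).
  assert (L : Q ^ N * E (2 * N)%nat s <= A ^ (2 * N) / INR (fact (2 * N))).
  { unfold E, A. rewrite Rpow_mult_distr. unfold Rdiv. rewrite <- Rmult_assoc.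
    apply Rmult_le_compat_r; [left; apply Rinv_0_lt_compat, INR_fact_lt_0|].
    apply Rmult_le_compat; try (apply pow_le; lra).
    - apply Rle_trans with ((Q + 1) ^ N); [apply pow_incr; lra | apply Rle_pow; [lra|lia]].
    - apply pow_incr; lra. }
  assert (L2 : A ^ (2 * N) / INR (fact (2 * N)) < eps / (D + 1)).
  { eapply Rle_lt_trans; [apply Rle_abs | exact HN]. }
  assert (D * (Q ^ N * E (2 * N)%nat s) <= D * (eps / (D + 1))).
  { apply Rmult_le_compat_l; lra. }
  assert (D * (eps / (D + 1)) <= eps).
  { apply Rmult_le_reg_r with (D + 1); [lra|].
    replace (D * (eps / (D + 1)) * (D + 1)) with (D * eps) by (field; lra). nra. }
  lra.
Qed.

Lemma is_cderive_reflect (g : R -> C) (s : R) (l : C) :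
  is_cderive g (- s) l -> is_cderive (fun t => g (- t)) s (Copp l).
Proof.
  intros H. eapply is_cderive_eq.
  - apply (is_derive_comp (K := R_AbsRing) (V := C_R_NormedModule) g (fun t => - t)); [exact H|].
    apply (is_derive_opp (K := R_AbsRing) (V := R_NormedModule) (fun t => t)), is_derive_id.
  - destruct l as [l1 l2]; unfold scal, opp, one; cbn; unfold prod_scal, scal; cbn.
    unfold mult, opp; cbn. unfold Copp; cbn. f_equal; ring.
Qed.

(** A second-order equation without first-order term is invariant under [s |-> -s], so the negative
    half is the one-sided case for [y (- s)], with first derivative [- y1 (- s)]. *)
Lemma ode_majorant_sym (y y1 q g : R -> C) (P P1 P2 G : R -> R) (Q X : R) :
  0 <= Q ->
  (forall s, -X <= s <= X -> is_cderive y s (y1 s)) ->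
  (forall s, -X <= s <= X -> is_cderive y1 s (Cplus (Cmult (q s) (y s)) (g s))) ->
  (forall s, 0 <= s <= X -> is_derive P s (P1 s)) ->
  (forall s, 0 <= s <= X -> is_derive P1 s (P2 s)) ->
  (forall s, -X <= s <= X -> Cmod (q s) <= Q) ->
  (forall s, -X <= s <= X -> Cmod (g s) <= G (Rabs s)) ->
  (forall s, 0 <= s <= X -> 0 <= P s) ->
  (forall s, 0 <= s <= X -> Q * P s + G s <= P2 s) ->
  Cmod (y 0) <= P 0 -> Cmod (y1 0) <= P1 0 ->
  forall s, -X <= s <= X -> Cmod (y s) <= P (Rabs s).
Proof.
  intros HQ Hy Hy1 HP HP1 Hq Hg HP0 H2 H0 H1 s Hs.
  destruct (Rle_dec 0 s) as [L|L].
  - rewrite Rabs_pos_eq by assumption.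
    apply (ode_majorant y y1 q g P P1 P2 G Q X); try assumption; try (intros t Ht); try lra;
      try (apply Hy || apply Hy1 || apply Hq); try lra.
    rewrite <- (Rabs_pos_eq t) at 2 by lra; apply Hg; lra.
  - rewrite Rabs_left by lra.
    replace s with (- - s) at 1 by ring.
    apply (ode_majorant (fun t => y (- t)) (fun t => Copp (y1 (- t))) (fun t => q (- t))
             (fun t => g (- t)) P P1 P2 G Q X);
      try assumption; try (intros t Ht); try lra.
    + apply is_cderive_reflect, Hy; lra.
    + eapply is_cderive_eq.
      { apply (is_cderive_opp (fun t => y1 (- t))), is_cderive_reflect, Hy1; lra. }
      ring.
    + apply Hq; lra.
    + rewrite <- (Rabs_pos_eq t) at 2 by lra; rewrite <- Rabs_Ropp; apply Hg; lra.
    + now rewrite Ropp_0.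
    + now rewrite Ropp_0, Cmod_opp.
Qed.

(** In the second derivative of [s^k exp (c s)], the term with [k (k - 1)] absorbs the source [g],
    the term with [c^2] absorbs [q y] because [Q <= c <= c^2], and the cross term is nonnegative. In
    the conditions at [0], the convention [0^0 = 1] and truncated subtraction treat [k = 0], [k = 1]
    and [k >= 2] uniformly. The lemma serves both the formal powers and the weighted remainders. *)
Lemma pow_exp_majorant (y y1 q g : R -> C) (B c Q X : R) (k : nat) :
  0 <= B -> 0 <= Q -> 1 <= c -> Q <= c ->
  (forall s, -X <= s <= X -> is_cderive y s (y1 s)) ->
  (forall s, -X <= s <= X -> is_cderive y1 s (Cplus (Cmult (q s) (y s)) (g s))) ->
  (forall s, -X <= s <= X -> Cmod (q s) <= Q) ->
  (forall s, -X <= s <= X ->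
     Cmod (g s) <= B * (INR k * INR (k - 1) * Rabs s ^ (k - 2) * exp (c * Rabs s))) ->
  Cmod (y 0) <= B * 0 ^ k ->
  Cmod (y1 0) <= B * (INR k * 0 ^ (k - 1) + c * 0 ^ k) ->
  forall s, -X <= s <= X -> Cmod (y s) <= B * (Rabs s ^ k * exp (c * Rabs s)).
Proof.
  intros HB HQ Hc1 HcQ Hy Hy1 Hq Hg H0 H1.
  apply (ode_majorant_sym y y1 q g
    (fun s => B * (s ^ k * exp (c * s)))
    (fun s => B * ((INR k * s ^ (k - 1) + c * s ^ k) * exp (c * s)))
    (fun s => B * ((INR k * INR (k - 1) * s ^ (k - 2) + 2 * c * INR k * s ^ (k - 1)
                    + c * c * s ^ k) * exp (c * s)))
    (fun s => B * (INR k * INR (k - 1) * s ^ (k - 2) * exp (c * s))) Q X); auto.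
  - intros s _. auto_derive; [exact I|]. rewrite <- Nat.sub_1_r. ring.
  - intros s _. auto_derive; [exact I|]. rewrite <- !Nat.sub_1_r.
    replace (k - 1 - 1)%nat with (k - 2)%nat by lia. ring.
  - intros s Hs. apply Rmult_le_pos, Rmult_le_pos; [lra|apply pow_le; lra|left; apply exp_pos].
  - intros s Hs. rewrite <- Rmult_assoc, (Rmult_comm Q), Rmult_assoc, <- Rmult_plus_distr_l.
    apply Rmult_le_compat_l; [assumption|].
    assert (Q * s ^ k <= c * c * s ^ k).
    { apply Rmult_le_compat_r; [apply pow_le; lra | nra]. }
    assert (0 <= 2 * c * INR k * s ^ (k - 1)).
    { repeat apply Rmult_le_pos; try lra; [apply pos_INR | apply pow_le; lra]. }
    rewrite <- Rmult_assoc, <- Rmult_plus_distr_r.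
    apply Rmult_le_compat_r; [left; apply exp_pos | lra].
  - rewrite Rmult_0_r, exp_0, Rmult_1_r; assumption.
  - rewrite Rmult_0_r, exp_0, Rmult_1_r; assumption.
Qed.

(** * Formal powers *)

Lemma locally_open_interval (P : R -> Prop) (a c x : R) :
  a < x < c -> (forall y, a < y < c -> P y) -> locally x P.
Proof.
  intros [H1 H2] H. apply (locally_interval P x a c); [exact H1 | exact H2|].
  intros y H3 H4; now apply H.
Qed.

Lemma is_cderive_CRInt (b : R) (g : R -> C) (x : R) :
  (forall s, -b < s < b -> continuous (U := C_UniformSpace) g s) ->
  -b < x < b -> is_cderive (CRInt g 0) x (g x).
Proof.
  intros Hg Hx.
  apply (is_derive_RInt (V := C_R_NormedModule) g (CRInt g 0) 0 x).
  - apply (locally_open_interval _ (-b) b); [assumption|].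
    intros y Hy. apply (RInt_correct (V := C_R_CompleteNormedModule)).
    apply (ex_RInt_continuous (V := C_R_CompleteNormedModule)).
    intros z Hz. apply (Hg z).
    revert Hz; unfold Rmin, Rmax; destruct (Rle_dec 0 y); lra.
  - exact (Hg x Hx).
Qed.

Section FormalPowers.

Variables (b : R) (q f : R -> C).
Hypothesis (Hf : nonvanishing_solution b q f) (Hf0 : f 0 = 1%C).

Lemma is_cderive_Cpow_sign (n : nat) (x : R) :
  -b < x < b -> exists l, is_cderive (fun s => Cpow_sign (f s ^ 2) n) x l.
Proof.
  intros Hx.
  assert (H2 : is_cderive (fun s => f s ^ 2)%C x
    (Cplus (Cmult (CDerive f x) (f x)) (Cmult (f x) (CDerive f x)))).
  { apply (is_derive_ext (K := R_AbsRing) (V := C_R_NormedModule) (fun s => Cmult (f s) (f s))).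
    - intros t; cbn; ring.
    - apply is_cderive_mult; apply is_cderive_CDerive, (nvs_d1 _ _ _ Hf x Hx). }
  unfold Cpow_sign; destruct (Nat.even n); eexists.
  - exact H2.
  - apply is_cderive_inv; [exact H2|].
    apply Cpow_nz, (nvs_neq0 _ _ _ Hf x Hx).
Qed.

Lemma is_cderive_recurrent_integral (X : R -> C) (m n : nat) (x : R) :
  (forall s, -b < s < b -> exists l, is_cderive X s l) ->
  -b < x < b ->
  is_cderive (fun x => INR n * CRInt (fun s => (X s * Cpow_sign (f s ^ 2) m)%C) 0 x)%C x
    (Cmult (INR n) (Cmult (X x) (Cpow_sign (f x ^ 2) m))).
Proof.
  intros HX Hx. eapply is_cderive_eq.
  - apply is_cderive_mult; [apply is_cderive_const|].
    apply (is_cderive_CRInt b (fun s => (X s * Cpow_sign (f s ^ 2) m)%C)); [|assumption].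
    intros s Hs. destruct (HX s Hs) as [l Hl], (is_cderive_Cpow_sign m s Hs) as [l' Hl'].
    eapply is_cderive_continuous, is_cderive_mult; eassumption.
  - cbn beta. ring.
Qed.

Lemma ex_cderive_Xint (n : nat) :
  forall x, -b < x < b -> exists l, is_cderive (Xint f n) x l.
Proof.
  induction n as [|n IH]; intros x Hx; eexists.
  - apply is_cderive_const.
  - now apply is_cderive_recurrent_integral.
Qed.

Lemma ex_cderive_Xtint (n : nat) :
  forall x, -b < x < b -> exists l, is_cderive (Xtint f n) x l.
Proof.
  induction n as [|n IH]; intros x Hx; eexists.
  - apply is_cderive_const.
  - now apply is_cderive_recurrent_integral.
Qed.

(** The parity of [k] selects the family and [n] the order within it. The two are separate because
    differentiating lowers the order by one but stays in the same family, whereas the formal power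
    of order [k - 1] uses the other one. *)
Definition recurrent_integral (k n : nat) : R -> C :=
  if Nat.odd k then Xint f n else Xtint f n.

Definition formal_power_d1 (k : nat) (x : R) : C :=
  (CDerive f x * recurrent_integral k k x +
   match k with
   | O => 0
   | S m => INR k * recurrent_integral k m x / f x
   end)%C.

(** The outermost weight is [1 / f^2] for either parity: the exponent is [(-1)^k] with [k] odd in
    one family and [(-1)^(k-1)] with [k] even in the other. *)
Lemma is_cderive_recurrent_integral_top (k : nat) (x : R) :
  -b < x < b ->
  is_cderive (recurrent_integral (S k) (S k)) x
    (Cdiv (Cmult (INR (S k)) (recurrent_integral (S k) k x)) (Cmult (f x) (f x))).
Proof.
  intros Hx. assert (Hfx := nvs_neq0 _ _ _ Hf x Hx).
  unfold recurrent_integral; destruct (Nat.odd (S k)) eqn:E.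
  - eapply is_cderive_eq.
    + apply (is_cderive_recurrent_integral (Xint f k)); [apply ex_cderive_Xint | assumption].
    + unfold Cpow_sign. rewrite <- Nat.negb_odd, E; cbn [negb].
      cbn [Cpow]. field; auto.
  - eapply is_cderive_eq.
    + apply (is_cderive_recurrent_integral (Xtint f k)); [apply ex_cderive_Xtint | assumption].
    + unfold Cpow_sign. rewrite Nat.odd_succ in E. rewrite E.
      cbn [Cpow]. field; auto.
Qed.

(** One level further in, the weight is [f^2] for either parity, and the result belongs to the
    family of [k] since [k + 2] and [k] have the same parity. *)
Lemma is_cderive_recurrent_integral_next (k : nat) (x : R) :
  -b < x < b ->
  is_cderive (recurrent_integral (S (S k)) (S k)) x
    (Cmult (Cmult (INR (S k)) (recurrent_integral k k x)) (Cmult (f x) (f x))).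
Proof.
  intros Hx.
  unfold recurrent_integral. change (Nat.odd (S (S k))) with (Nat.odd k).
  destruct (Nat.odd k) eqn:E.
  - eapply is_cderive_eq.
    + apply (is_cderive_recurrent_integral (Xint f k)); [apply ex_cderive_Xint | assumption].
    + unfold Cpow_sign. rewrite Nat.even_succ, E. cbn [Cpow]. ring.
  - eapply is_cderive_eq.
    + apply (is_cderive_recurrent_integral (Xtint f k)); [apply ex_cderive_Xtint | assumption].
    + unfold Cpow_sign. rewrite <- Nat.negb_odd, E; cbn [negb Cpow]. ring.
Qed.

Lemma is_cderive_formal_power (k : nat) (x : R) :
  -b < x < b -> is_cderive (formal_power f k) x (formal_power_d1 k x).
Proof.
  intros Hx. assert (Hfx := nvs_neq0 _ _ _ Hf x Hx).
  assert (Hd := is_cderive_CDerive _ _ (nvs_d1 _ _ _ Hf x Hx)).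
  apply (is_derive_ext (K := R_AbsRing) (V := C_R_NormedModule)
           (fun x => Cmult (f x) (recurrent_integral k k x))).
  { intros t; unfold formal_power, recurrent_integral; now destruct (Nat.odd k). }
  destruct k as [|k]; eapply is_cderive_eq.
  - apply is_cderive_mult; [exact Hd | exact (is_cderive_const 1%C x)].
  - unfold formal_power_d1, recurrent_integral; cbn. ring.
  - apply is_cderive_mult; [exact Hd | now apply is_cderive_recurrent_integral_top].
  - unfold formal_power_d1. now field.
Qed.

Lemma CDerive2_eq (x : R) :
  -b < x < b -> is_cderive (CDerive f) x (Cmult (q x) (f x)).
Proof.
  intros Hx. eapply is_cderive_eq.
  - apply is_cderive_CDerive, (nvs_d2 _ _ _ Hf x Hx).
  - assert (H := nvs_eq _ _ _ Hf x Hx). cbn [CDerive_n] in H.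
    change (CDerive (CDerive f) x) with (CDerive_n f 2 x).
    replace (CDerive_n f 2 x) with (CDerive_n f 2 x - q x * f x + q x * f x)%C by ring.
    cbn [CDerive_n]; rewrite H; ring.
Qed.

(** Behind this is the factorization [L y = (f^2 (y / f)')' / f], which strips two integrations off
    the recurrent integral. For [k < 2] the truncated [k - 2] does no harm, because the coefficient
    [k (k - 1)] is zero. *)
Lemma is_cderive_formal_power_d1 (k : nat) (x : R) :
  -b < x < b ->
  is_cderive (formal_power_d1 k) x
    (Cplus (Cmult (q x) (formal_power f k x))
           (Cmult (INR k * INR (k - 1))%R (formal_power f (k - 2) x))).
Proof.
  intros Hx. assert (Hfx := nvs_neq0 _ _ _ Hf x Hx).
  assert (Hd := is_cderive_CDerive _ _ (nvs_d1 _ _ _ Hf x Hx)).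
  assert (Hd2 := CDerive2_eq x Hx).
  assert (E : formal_power f k x = (f x * recurrent_integral k k x)%C).
  { unfold formal_power, recurrent_integral; now destruct (Nat.odd k). }
  rewrite E. destruct k as [|[|k]]; unfold formal_power_d1.
  - eapply is_cderive_eq.
    + apply is_cderive_plus; [|apply is_cderive_const].
      apply is_cderive_mult; [exact Hd2 | exact (is_cderive_const 1%C x)].
    + unfold recurrent_integral; cbn -[INR]. rewrite Rmult_0_l. ring.
  - eapply is_cderive_eq.
    + apply is_cderive_plus.
      * apply is_cderive_mult; [exact Hd2 | now apply is_cderive_recurrent_integral_top].
      * apply is_cderive_mult.
        -- apply is_cderive_mult; [apply is_cderive_const|].
           exact (is_cderive_const 1%C x).
        -- apply is_cderive_inv; [exact Hd | exact Hfx].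
    + unfold recurrent_integral; cbn. rewrite Rmult_0_r. field; exact Hfx.
  - eapply is_cderive_eq.
    + apply is_cderive_plus.
      * apply is_cderive_mult; [exact Hd2 | now apply is_cderive_recurrent_integral_top].
      * apply is_cderive_mult.
        -- apply is_cderive_mult; [apply is_cderive_const|].
           now apply is_cderive_recurrent_integral_next.
        -- apply is_cderive_inv; [exact Hd | exact Hfx].
    + replace (formal_power f (S (S k) - 2) x) with (f x * recurrent_integral k k x)%C.
      2:{ replace (S (S k) - 2)%nat with k by lia.
          unfold formal_power, recurrent_integral; now destruct (Nat.odd k). }
      replace (S (S k) - 1)%nat with (S k) by lia.
      rewrite RtoC_mult. field; exact Hfx.
Qed.

(** Consequently the only Cauchy data at [0] that can be nonzero are the values of
    [formal_power f 0], [formal_power_d1 0] and [formal_power_d1 1]. *)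
Lemma recurrent_integral_0 (k n : nat) : recurrent_integral k (S n) 0 = 0%C.
Proof.
  unfold recurrent_integral; destruct (Nat.odd k); cbn [Xint Xtint];
    unfold CRInt; rewrite (RInt_point (V := C_R_CompleteNormedModule));
    apply Cmult_0_r.
Qed.

Lemma formal_power_at_0 (k : nat) : formal_power f (S k) 0 = 0%C.
Proof.
  transitivity (f 0 * recurrent_integral (S k) (S k) 0)%C.
  - unfold formal_power, recurrent_integral; now destruct (Nat.odd (S k)).
  - rewrite recurrent_integral_0; ring.
Qed.

Lemma formal_power_0_at_0 : formal_power f 0 0 = 1%C.
Proof. unfold formal_power; cbn; rewrite Hf0; ring. Qed.

Lemma formal_power_d1_0_at_0 : formal_power_d1 0 0 = CDerive f 0.
Proof. unfold formal_power_d1, recurrent_integral; cbn. ring. Qed.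

Lemma formal_power_d1_1_at_0 : formal_power_d1 1 0 = 1%C.
Proof.
  unfold formal_power_d1. rewrite recurrent_integral_0, Hf0.
  unfold recurrent_integral; cbn. field.
Qed.

Lemma formal_power_d1_at_0 (k : nat) : formal_power_d1 (S (S k)) 0 = 0%C.
Proof.
  unfold formal_power_d1. rewrite !recurrent_integral_0, Hf0. field.
Qed.

(** Since [phi_k'' = q phi_k + k (k - 1) phi_(k-2)], the function
    [s^k exp (c s)] is a majorant as soon as [c^2 >= sup |q|] and [c >= |f' 0|]. *)
Lemma formal_power_bound (c Q r : R) (k : nat) :
  0 <= Q -> 1 <= c -> Q <= c -> Cmod (CDerive f 0) <= c -> r < b ->
  (forall s, -r <= s <= r -> Cmod (q s) <= Q) ->
  forall s, -r <= s <= r -> Cmod (formal_power f k s) <= Rabs s ^ k * exp (c * Rabs s).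
Proof.
  intros HQ Hc HcQ Hca Hr Hq.
  induction k as [k IH] using (well_founded_induction Wf_nat.lt_wf).
  intros s Hs. rewrite <- (Rmult_1_l (_ * _)).
  apply (pow_exp_majorant (formal_power f k) (formal_power_d1 k) q
    (fun s => RtoC (INR k * INR (k - 1)) * formal_power f (k - 2) s)%C 1 c Q r k); auto; try lra.
  - intros t Ht; apply is_cderive_formal_power; lra.
  - intros t Ht; apply is_cderive_formal_power_d1; lra.
  - intros t Ht. rewrite Cmod_mult, Cmod_R, Rabs_pos_eq by (apply Rmult_le_pos; apply pos_INR).
    destruct k as [|[|k]]; [cbn; lra | cbn; lra |].
    rewrite Rmult_1_l, (Rmult_assoc _ (Rabs t ^ _)). apply Rmult_le_compat_l.
    + apply Rmult_le_pos; apply pos_INR.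
    + apply IH; [lia | assumption].
  - destruct k as [|k].
    + rewrite formal_power_0_at_0, Cmod_1; cbn; lra.
    + rewrite formal_power_at_0, Cmod_0; cbn; lra.
  - destruct k as [|[|k]].
    + rewrite formal_power_d1_0_at_0; cbn; lra.
    + rewrite formal_power_d1_1_at_0, Cmod_1; cbn; lra.
    + rewrite formal_power_d1_at_0, Cmod_0. cbn -[INR]. lra.
Qed.

End FormalPowers.

(** * Bump functions *)

(** [bump_deriv w n k] is the [k]-th derivative of [s |-> (w^2 - s^2)^n],
    obtained by applying Leibniz' rule to [(w^2 - s^2) * (w^2 - s^2)^(n-1)]. *)
Fixpoint bump_deriv (w : R) (n k : nat) (s : R) : R :=
  match n with
  | O => match k with O => 1 | S _ => 0 end
  | S m => (w ^ 2 - s ^ 2) * bump_deriv w m k s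
           - 2 * INR k * s * bump_deriv w m (k - 1) s
           - INR k * INR (k - 1) * bump_deriv w m (k - 2) s
  end.

Lemma is_derive_bump_deriv (w : R) (n k : nat) (s : R) :
  is_derive (bump_deriv w n k) s (bump_deriv w n (S k) s).
Proof.
  revert k; induction n as [|n IH]; intros k.
  - destruct k; apply (is_derive_const (K := R_AbsRing) (V := R_NormedModule)).
  - cbn [bump_deriv].
    assert (E : forall j, Derive (bump_deriv w n j) s = bump_deriv w n (S j) s).
    { intros j; apply is_derive_unique, IH. }
    auto_derive.
    { repeat split; eexists; apply IH. }
    rewrite !E.
    (* For [k = 0] and [k = 1] truncated subtraction spoils the shift of indices, but exactly in
       terms whose coefficient vanishes. *)
    destruct k as [|[|k]].
    + cbn; ring.
    + cbn; ring.
    + replace (S (S (S k)) - 2)%nat with (S k) by lia.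
      replace (S (S k) - 2)%nat with k by lia.
      replace (S (S (S k)) - 1)%nat with (S (S k)) by lia.
      replace (S (S k) - 1)%nat with (S k) by lia.
      rewrite !S_INR. ring.
Qed.

Lemma continuous_bump_deriv (w : R) (n k : nat) (s : R) : continuous (bump_deriv w n k) s.
Proof.
  apply (ex_derive_continuous (K := R_AbsRing) (V := R_NormedModule)).
  eexists; apply is_derive_bump_deriv.
Qed.

(** At an endpoint the leading term of the recursion drops out. The other two lower [n] by one and,
    when their coefficient is nonzero, [k] by at least one, so the inequality [k < n] is
    preserved. *)
Lemma bump_deriv_endpoint (w : R) (n k : nat) (s : R) :
  s ^ 2 = w ^ 2 -> (k < n)%nat -> bump_deriv w n k s = 0.
Proof.
  intros Hs; revert k; induction n as [|n IH]; intros k Hk; [lia|].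
  cbn [bump_deriv]. rewrite Hs.
  destruct k as [|k]; [cbn; ring|].
  rewrite (IH (S k - 1)%nat), (IH (S k - 2)%nat) by lia. ring.
Qed.

(** The base [4 = 1 + 2 + 1] adds the three coefficients of the recursion, where [|w^2 - s^2|] and
    [|s|] are at most [1]; the factors [k] and [k (k - 1)] are absorbed by [k!]. *)
Lemma bump_deriv_bound (w : R) (n k : nat) (s : R) :
  w <= 1 -> - w <= s <= w -> Rabs (bump_deriv w n k s) <= 4 ^ n * INR (fact k).
Proof.
  intros Hw Hs; revert k; induction n as [|n IH]; intros k.
  - assert (0 < INR (fact k)) by apply INR_fact_lt_0.
    destruct k; cbn [bump_deriv]; [cbn; rewrite Rabs_R1; lra | rewrite Rabs_R0; cbn -[fact INR]; lra].
  - cbn [bump_deriv].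
    assert (H1 : INR k * INR (fact (k - 1)) <= INR (fact k)).
    { destruct k as [|k]; [cbn; lra|]. replace (S k - 1)%nat with k by lia.
      rewrite <- mult_INR; apply Rle_refl. }
    assert (H2 : INR k * INR (k - 1) * INR (fact (k - 2)) <= INR (fact k)).
    { destruct k as [|[|k]]; [cbn; lra | cbn; lra |].
      replace (S (S k) - 1)%nat with (S k) by lia. replace (S (S k) - 2)%nat with k by lia.
      rewrite Rmult_assoc, <- !mult_INR; apply Rle_refl. }
    assert (H4 : 0 <= 4 ^ n) by (apply pow_le; lra).
    assert (A0 : Rabs (w ^ 2 - s ^ 2) <= 1) by (rewrite Rabs_pos_eq; nra).
    assert (A1 : Rabs s <= 1) by (apply Rabs_le; lra).
    assert (B0 := IH k). assert (B1 := IH (k - 1)%nat). assert (B2 := IH (k - 2)%nat).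
    assert (P0 := Rabs_pos (bump_deriv w n k s)).
    assert (P1 := Rabs_pos (bump_deriv w n (k - 1) s)).
    assert (P2 := Rabs_pos (bump_deriv w n (k - 2) s)).
    assert (Pk := pos_INR k). assert (Pk1 := pos_INR (k - 1)).
    apply Rle_trans with (Rabs ((w ^ 2 - s ^ 2) * bump_deriv w n k s)
       + Rabs (2 * INR k * s * bump_deriv w n (k - 1) s)
       + Rabs (INR k * INR (k - 1) * bump_deriv w n (k - 2) s)).
    { unfold Rminus. eapply Rle_trans; [apply Rabs_triang|]. rewrite Rabs_Ropp.
      apply Rplus_le_compat_r. eapply Rle_trans; [apply Rabs_triang|]. rewrite Rabs_Ropp; lra. }
    rewrite !Rabs_mult, (Rabs_pos_eq 2), (Rabs_pos_eq (INR k)), (Rabs_pos_eq (INR (k - 1))) by lra.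
    assert (C0 : Rabs (w ^ 2 - s ^ 2) * Rabs (bump_deriv w n k s) <= 4 ^ n * INR (fact k)).
    { rewrite <- (Rmult_1_l (4 ^ n * _)). apply Rmult_le_compat; auto using Rabs_pos. }
    assert (C1 : 2 * INR k * Rabs s * Rabs (bump_deriv w n (k - 1) s) <= 2 * (4 ^ n * INR (fact k))).
    { apply Rle_trans with (2 * INR k * 1 * (4 ^ n * INR (fact (k - 1)))).
      - apply Rmult_le_compat; auto; [|apply Rmult_le_compat_l; lra].
        apply Rmult_le_pos; [lra | apply Rabs_pos].
      - replace (2 * INR k * 1 * (4 ^ n * INR (fact (k - 1))))
          with (2 * (4 ^ n * (INR k * INR (fact (k - 1))))) by ring.
        apply Rmult_le_compat_l; [lra|]. now apply Rmult_le_compat_l. }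
    assert (C2 : INR k * INR (k - 1) * Rabs (bump_deriv w n (k - 2) s) <= 4 ^ n * INR (fact k)).
    { apply Rle_trans with (INR k * INR (k - 1) * (4 ^ n * INR (fact (k - 2)))).
      - apply Rmult_le_compat_l; [now apply Rmult_le_pos | exact B2].
      - replace (INR k * INR (k - 1) * (4 ^ n * INR (fact (k - 2))))
          with (4 ^ n * (INR k * INR (k - 1) * INR (fact (k - 2)))) by ring.
        now apply Rmult_le_compat_l. }
    change (4 ^ S n) with (4 * 4 ^ n). lra.
Qed.

Lemma bump_deriv_0 (w : R) (n : nat) (s : R) : bump_deriv w n 0 s = (w ^ 2 - s ^ 2) ^ n.
Proof. induction n as [|n IH]; [reflexivity|]. cbn -[pow]. rewrite IH. cbn; ring. Qed.

(** * Joint continuity *)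

(** Only [u_xx] and [u_t] are assumed jointly continuous; this lemma carries continuity down to
    [u_x] and [u]. By the mean value theorem in [x], the increment of [g] in [t] at abscissa [u]
    differs from the one at abscissa [0] by [u] times an increment of [g1] in [t], which is small
    uniformly on compact ranges of [x]. *)
Lemma continuity_2d_pt_of_partial (b tau : R) (g g1 : R -> R -> R) :
  (forall x t, -b < x < b -> Rabs t < tau -> is_derive (fun y => g y t) x (g1 x t)) ->
  (forall x t, -b < x < b -> Rabs t < tau -> continuity_2d_pt g1 x t) ->
  (forall t, Rabs t < tau -> continuous (g 0) t) ->
  forall x t, -b < x < b -> Rabs t < tau -> continuity_2d_pt g x t.
Proof.
  intros Hd H1 H0 x t Hx Ht eps.
  (* Any bound strictly between [|x|] and [b] works: the compact range then contains a neighbourhood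
     of [x]. *)
  set (X := (Rabs x + b) / 2).
  assert (HX : Rabs x < X < b) by (unfold X; assert (Rabs x < b) by (apply Rabs_def1; lra); lra).
  (* The mean value theorem multiplies this tolerance by a length at most [b], leaving one third of
     [eps]. *)
  assert (He : 0 < eps / (3 * b)) by (apply Rdiv_lt_0_compat; [apply cond_pos | lra]).
  destruct (uniform_continuity_2d_1d g1 (- X) X t) with (eps := mkposreal _ He) as [d1 Hd1].
  { intros s Hs; apply H1; [lra | assumption]. }
  assert (He3 : 0 < eps / 3) by (apply Rdiv_lt_0_compat; [apply cond_pos | lra]).
  assert (C0 := H0 t Ht).
  apply (proj1 (filterlim_locally (U := R_UniformSpace) _ _)) with (eps := mkposreal _ He3) in C0.
  destruct C0 as [d2 Hd2].
  assert (C1 : continuous (fun y => g y t) x).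
  { apply (ex_derive_continuous (K := R_AbsRing) (V := R_NormedModule)).
    eexists; now apply Hd. }
  apply (proj1 (filterlim_locally (U := R_UniformSpace) _ _)) with (eps := mkposreal _ He3) in C1.
  destruct C1 as [d3 Hd3].
  assert (Hd4 : 0 < Rmin (Rmin d1 d2) (Rmin d3 (Rmin (X - Rabs x) (tau - Rabs t)))).
  { repeat apply Rmin_pos; try apply cond_pos; lra. }
  exists (mkposreal _ Hd4); cbn; intros u v Hu Hv.
  assert (L1 := Rmin_l (Rmin d1 d2) (Rmin d3 (Rmin (X - Rabs x) (tau - Rabs t)))).
  assert (L2 := Rmin_r (Rmin d1 d2) (Rmin d3 (Rmin (X - Rabs x) (tau - Rabs t)))).
  assert (L3 := Rmin_l d1 d2). assert (L4 := Rmin_r d1 d2).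
  assert (L5 := Rmin_l d3 (Rmin (X - Rabs x) (tau - Rabs t))).
  assert (L6 := Rmin_r d3 (Rmin (X - Rabs x) (tau - Rabs t))).
  assert (L7 := Rmin_l (X - Rabs x) (tau - Rabs t)).
  assert (L8 := Rmin_r (X - Rabs x) (tau - Rabs t)).
  assert (Hu' : Rabs u < X).
  { replace u with (u - x + x) by ring. eapply Rle_lt_trans; [apply Rabs_triang|]. lra. }
  assert (Hv' : Rabs v < tau).
  { replace v with (v - t + t) by ring. eapply Rle_lt_trans; [apply Rabs_triang|]. lra. }
  apply Rabs_lt_between in Hu'.
  assert (B2 : Rabs (g 0 v - g 0 t) < eps / 3) by (apply (Hd2 v); change (Rabs (v - t) < d2); lra).
  assert (B3 : Rabs (g u t - g x t) < eps / 3) by (apply (Hd3 u); change (Rabs (u - x) < d3); lra).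
  assert (B1 : Rabs ((g u v - g u t) - (g 0 v - g 0 t)) <= eps / 3).
  { destruct (MVT_gen (fun s => g s v - g s t) 0 u (fun s => g1 s v - g1 s t)) as [c [Hc E]].
    - intros s Hs. apply (is_derive_minus (K := R_AbsRing) (V := R_NormedModule) (fun s => g s v) (fun s => g s t));
        apply Hd; auto; revert Hs; unfold Rmin, Rmax; destruct (Rle_dec 0 u); lra.
    - intros s Hs. apply continuity_pt_filterlim.
      apply (ex_derive_continuous (K := R_AbsRing) (V := R_NormedModule) (fun s => g s v - g s t)). exists (g1 s v - g1 s t).
      apply (is_derive_minus (K := R_AbsRing) (V := R_NormedModule) (fun s => g s v) (fun s => g s t));
        apply Hd; auto; revert Hs; unfold Rmin, Rmax; destruct (Rle_dec 0 u); lra.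
    - rewrite E, Rminus_0_r, Rabs_mult.
      assert (Hc' : - X <= c <= X) by (revert Hc; unfold Rmin, Rmax; destruct (Rle_dec 0 u); lra).
      assert (Hb : Rabs (g1 c v - g1 c t) < eps / (3 * b)).
      { apply Rabs_lt_between' in Hv.
        apply (Hd1 c t c v); auto; try (assert (Hp := cond_pos d1); lra).
        rewrite Rminus_diag, Rabs_R0; apply cond_pos. }
      apply Rle_trans with (eps / (3 * b) * b).
      + apply Rmult_le_compat; try apply Rabs_pos; [lra|]. apply Rabs_le; lra.
      + right; field; lra. }
  replace (g u v - g x t) with ((g u v - g u t - (g 0 v - g 0 t)) + ((g 0 v - g 0 t) + (g u t - g x t)))
    by ring.
  eapply Rle_lt_trans; [apply Rabs_triang|].
  assert (B4 := Rabs_triang (g 0 v - g 0 t) (g u t - g x t)). lra.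
Qed.

(** Uniform continuity with tolerance [1] gives a step size. Walking from the corner [(a, c)] to
    [(x, y)] along the segment takes at most [N + 1] such steps, and each changes [g] by less than
    [1]. *)
Lemma continuity_2d_pt_bounded (g : R -> R -> R) (a b c d : R) :
  (forall x y, a <= x <= b -> c <= y <= d -> continuity_2d_pt g x y) ->
  exists M, 0 <= M /\ forall x y, a <= x <= b -> c <= y <= d -> Rabs (g x y) <= M.
Proof.
  intros H.
  destruct (uniform_continuity_2d g a b c d H (mkposreal 1 Rlt_0_1)) as [del Hdel].
  (* The maximum with [0] keeps the argument of the floor nonnegative even when the rectangle is
     empty. *)
  destruct (nfloor_ex (Rmax (Rmax (b - a) (d - c)) 0 / del)) as [N HN].
  { apply Rle_div_r; [apply cond_pos|]. rewrite Rmult_0_l; apply Rmax_r. }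
  exists (Rabs (g a c) + (INR N + 1)); split.
  { assert (A0 := Rabs_pos (g a c)); assert (A1 := pos_INR N); lra. }
  intros x y Hx Hy.
  set (n := INR N + 1). assert (Hn : 0 < n) by (unfold n; assert (A1 := pos_INR N); lra).
  assert (L : Rmax (Rmax (b - a) (d - c)) 0 < n * del).
  { apply Rlt_div_l; [apply cond_pos|]; apply HN. }
  assert (La : x - a < n * del).
  { eapply Rle_lt_trans; [|exact L]. eapply Rle_trans; [|apply Rmax_l].
    eapply Rle_trans; [|apply Rmax_l]; lra. }
  assert (Lc : y - c < n * del).
  { eapply Rle_lt_trans; [|exact L]. eapply Rle_trans; [|apply Rmax_l].
    eapply Rle_trans; [|apply Rmax_r]; lra. }
  assert (IT : forall k, (k <= S N)%nat ->
     Rabs (g (a + INR k / n * (x - a)) (c + INR k / n * (y - c)) - g a c) <= INR k).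
  { induction k as [|k IH]; intros Hk.
    - cbn. unfold Rdiv; rewrite !Rmult_0_l, !Rplus_0_r, Rminus_diag, Rabs_R0; lra.
    - specialize (IH ltac:(lia)). rewrite S_INR.
      assert (T0 : 0 <= INR k / n).
      { apply Rle_div_r; [assumption|]. rewrite Rmult_0_l; apply pos_INR. }
      assert (T1 : (INR k + 1) / n <= 1).
      { apply Rle_div_l; [assumption|]. unfold n; rewrite Rmult_1_l, <- !S_INR; apply le_INR; lia. }
      assert (Ti : 0 < / n) by now apply Rinv_0_lt_compat.
      assert (T2 : (INR k + 1) / n = INR k / n + / n) by (field; lra).
      rewrite T2 in *. set (h := INR k / n) in *.
      assert (Sx : / n * (x - a) < del).
      { rewrite Rmult_comm; apply Rlt_div_l; lra. }
      assert (Sy : / n * (y - c) < del).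
      { rewrite Rmult_comm; apply Rlt_div_l; lra. }
      assert (St : Rabs (g (a + (h + / n) * (x - a)) (c + (h + / n) * (y - c))
                         - g (a + h * (x - a)) (c + h * (y - c))) < 1).
      { apply Hdel; try nra.
        - replace (_ - _) with (/ n * (x - a)) by ring. rewrite Rabs_pos_eq; nra.
        - replace (_ - _) with (/ n * (y - c)) by ring. rewrite Rabs_pos_eq; nra. }
      eapply Rle_trans; [|apply Rplus_le_compat; [exact IH | left; exact St]].
      rewrite (Rplus_comm (Rabs _)). eapply Rle_trans; [|apply Rabs_triang]. right; f_equal; ring. }
  specialize (IT (S N) (le_n _)). rewrite S_INR in IT. fold n in IT.
  replace (n / n) with 1 in IT by (field; lra).
  rewrite !Rmult_1_l in IT.
  replace (a + (x - a)) with x in IT by ring. replace (c + (y - c)) with y in IT by ring.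
  replace (g x y) with (g a c + (g x y - g a c)) by ring.
  eapply Rle_trans; [apply Rabs_triang|]; lra.
Qed.

(** * Integration against a weight *)

Lemma continuous_Re (g : R -> C) (t : R) :
  continuous (U := C_UniformSpace) g t -> continuous (fun s => Re (g s)) t.
Proof.
  intros H. apply (continuous_comp (V := C_UniformSpace) g fst); [exact H|].
  destruct (g t); apply (continuous_fst (U := R_UniformSpace) (V := R_UniformSpace)).
Qed.

Lemma continuous_Im (g : R -> C) (t : R) :
  continuous (U := C_UniformSpace) g t -> continuous (fun s => Im (g s)) t.
Proof.
  intros H. apply (continuous_comp (V := C_UniformSpace) g snd); [exact H|].
  destruct (g t); apply (continuous_snd (U := R_UniformSpace) (V := R_UniformSpace)).
Qed.

(** Coquelicot's integrals produce equations at types convertible to [R] that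
    [ring] does not recognize. *)
Ltac real_ring := match goal with |- @eq _ ?a ?b => change (@eq R a b); ring end.

(** Two real integrals instead of one complex integral, so that integration by parts and
    differentiation under the integral sign come from the real theory. *)
Definition pairing (l m : R) (g : R -> C) (psi : R -> R) : C :=
  (RInt (fun t => Re (g t) * psi t) l m, RInt (fun t => Im (g t) * psi t) l m).

Section Pairing.

Variables (l m : R).
Hypothesis Hlm : l < m.

Lemma ex_RInt_between (h : R -> R) :
  (forall t, l <= t <= m -> continuous h t) -> ex_RInt h l m.
Proof.
  intros H. apply (ex_RInt_continuous (V := R_CompleteNormedModule)).
  rewrite Rmin_left, Rmax_right by lra; exact H.
Qed.

Lemma ex_RInt_mult_between (h psi : R -> R) :
  (forall t, l <= t <= m -> continuous h t) -> (forall t, continuous psi t) ->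
  ex_RInt (fun t => h t * psi t) l m.
Proof.
  intros H Hp. apply ex_RInt_between; intros t Ht.
  apply (continuous_mult (K := R_AbsRing)); auto.
Qed.

Lemma pairing_ext (g h : R -> C) (psi : R -> R) :
  (forall t, l <= t <= m -> g t = h t) -> pairing l m g psi = pairing l m h psi.
Proof.
  intros H; unfold pairing; f_equal; apply RInt_ext;
    rewrite Rmin_left, Rmax_right by lra; intros t Ht; rewrite H by lra; reflexivity.
Qed.

Lemma RInt_ext_between (h k : R -> R) :
  (forall t, l <= t <= m -> h t = k t) -> RInt h l m = RInt k l m.
Proof.
  intros H; apply RInt_ext; rewrite Rmin_left, Rmax_right by lra; intros t Ht; apply H; lra.
Qed.

Lemma RInt_linear (a c : R) (h k psi : R -> R) :
  (forall t, l <= t <= m -> continuous h t) -> (forall t, l <= t <= m -> continuous k t) ->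
  (forall t, continuous psi t) ->
  RInt (fun t => (a * h t + c * k t) * psi t) l m =
  a * RInt (fun t => h t * psi t) l m + c * RInt (fun t => k t * psi t) l m.
Proof.
  intros Hh Hk Hp.
  rewrite <- !(RInt_scal (V := R_CompleteNormedModule)) by now apply ex_RInt_mult_between.
  rewrite <- (RInt_plus (V := R_CompleteNormedModule)).
  - apply RInt_ext; intros; unfold plus, scal; cbn; unfold mult; cbn; ring.
  - now apply (ex_RInt_scal (V := R_CompleteNormedModule)), ex_RInt_mult_between.
  - now apply (ex_RInt_scal (V := R_CompleteNormedModule)), ex_RInt_mult_between.
Qed.

Lemma pairing_linear (z w : C) (g h : R -> C) (psi : R -> R) :
  (forall t, l <= t <= m -> continuous (U := C_UniformSpace) g t) ->
  (forall t, l <= t <= m -> continuous (U := C_UniformSpace) h t) ->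
  (forall t, continuous psi t) ->
  pairing l m (fun t => z * g t + w * h t)%C psi =
  (z * pairing l m g psi + w * pairing l m h psi)%C.
Proof.
  intros Hg Hh Hp.
  assert (Hgr : forall t, l <= t <= m -> continuous (fun s => Re (g s)) t)
    by (intros; now apply continuous_Re, Hg).
  assert (Hgi : forall t, l <= t <= m -> continuous (fun s => Im (g s)) t)
    by (intros; now apply continuous_Im, Hg).
  assert (Hhr : forall t, l <= t <= m -> continuous (fun s => Re (h s)) t)
    by (intros; now apply continuous_Re, Hh).
  assert (Hhi : forall t, l <= t <= m -> continuous (fun s => Im (h s)) t)
    by (intros; now apply continuous_Im, Hh).
  assert (comb : forall (a c : R) (u v : R -> R),
    (forall t, l <= t <= m -> continuous u t) -> (forall t, l <= t <= m -> continuous v t) ->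
    forall t, l <= t <= m -> continuous (fun s => a * u s + c * v s) t).
  { intros a c u v Hu Hv t Ht. apply (continuous_plus (V := R_NormedModule));
      apply (continuous_scal_r (V := R_NormedModule)); auto. }
  unfold pairing, Cmult, Cplus; cbn [fst snd]. f_equal.
  - rewrite (RInt_ext_between _ (fun t => (1 * (Re z * Re (g t) + - Im z * Im (g t))
       + 1 * (Re w * Re (h t) + - Im w * Im (h t))) * psi t)).
    + rewrite RInt_linear by auto. rewrite !RInt_linear by auto. unfold Re, Im; real_ring.
    + intros; unfold Re, Im; cbn; ring.
  - rewrite (RInt_ext_between _ (fun t => (1 * (Re z * Im (g t) + Im z * Re (g t))
       + 1 * (Re w * Im (h t) + Im w * Re (h t))) * psi t)).
    + rewrite RInt_linear by auto. rewrite !RInt_linear by auto. unfold Re, Im; real_ring.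
    + intros; unfold Re, Im; cbn; ring.
Qed.

Lemma pairing_const (z : C) (psi : R -> R) :
  (forall t, continuous psi t) ->
  pairing l m (fun _ => z) psi = (z * RtoC (RInt psi l m))%C.
Proof.
  intros Hp. unfold pairing, Cmult; cbn [fst snd RtoC].
  assert (E : forall a, RInt (fun t => a * psi t) l m = a * RInt psi l m).
  { intros a. apply (RInt_scal (V := R_CompleteNormedModule)). now apply ex_RInt_between. }
  rewrite !E. f_equal; unfold Re, Im; real_ring.
Qed.

Lemma Cmod_le_Re_Im (z : C) : Cmod z <= Rabs (Re z) + Rabs (Im z).
Proof.
  destruct z as [p r]. replace ((p, r) : C) with (RtoC p + Ci * RtoC r)%C.
  - eapply Rle_trans; [apply Cmod_triangle|].
    rewrite Cmod_mult, Cmod_Ci, !Cmod_R. unfold Re, Im; cbn.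
    replace (p + (0 * r - 1 * 0)) with p by ring. replace (0 + (0 * 0 + 1 * r)) with r by ring. lra.
  - unfold Cplus, Cmult; cbn; f_equal; ring.
Qed.

Lemma im_le_Cmod (z : C) : Rabs (Im z) <= Cmod z.
Proof. eapply Rle_trans; [apply Rmax_r | apply Rmax_Cmod]. Qed.

(** The factor [2] is the price of estimating the two components separately. It does not depend on
    the weight, so it only enlarges constants in the limit arguments. *)
Lemma pairing_bound (g : R -> C) (psi chi : R -> R) (M : R) :
  (forall t, l <= t <= m -> continuous (U := C_UniformSpace) g t) ->
  (forall t, continuous psi t) -> (forall t, continuous chi t) ->
  (forall t, l <= t <= m -> Cmod (g t) <= M) ->
  (forall t, l <= t <= m -> Rabs (psi t) <= chi t) ->
  Cmod (pairing l m g psi) <= 2 * M * RInt chi l m.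
Proof.
  intros Hg Hp Hc HM Hb.
  assert (B : forall h : R -> R, (forall t, l <= t <= m -> continuous h t) ->
    (forall t, l <= t <= m -> Rabs (h t) <= M) ->
    Rabs (RInt (fun t => h t * psi t) l m) <= M * RInt chi l m).
  { intros h Hh HhM.
    eapply Rle_trans; [apply abs_RInt_le; [lra | now apply ex_RInt_mult_between]|].
    rewrite <- (RInt_scal (V := R_CompleteNormedModule)) by now apply ex_RInt_between.
    apply RInt_le; [lra | | |].
    - apply ex_RInt_between; intros t Ht.
      apply (continuous_comp (fun t => h t * psi t) Rabs); [|apply continuous_Rabs].
      apply (continuous_mult (K := R_AbsRing)); auto.
    - apply (ex_RInt_scal (V := R_CompleteNormedModule)). now apply ex_RInt_between.
    - intros t Ht. rewrite Rabs_mult. apply Rmult_le_compat; try apply Rabs_pos.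
      + apply HhM; lra.
      + apply Hb; lra. }
  eapply Rle_trans; [apply Cmod_le_Re_Im|]. unfold pairing; cbn [Re Im fst snd].
  replace (2 * M * RInt chi l m) with (M * RInt chi l m + M * RInt chi l m) by ring.
  apply Rplus_le_compat; apply B.
  - intros; now apply continuous_Re, Hg.
  - intros t Ht; eapply Rle_trans; [apply re_le_Cmod | auto].
  - intros; now apply continuous_Im, Hg.
  - intros t Ht; eapply Rle_trans; [apply im_le_Cmod | auto].
Qed.

Lemma pairing_by_parts (g g1 : R -> C) (psi psi1 : R -> R) :
  (forall t, l <= t <= m -> is_cderive g t (g1 t)) ->
  (forall t, l <= t <= m -> continuous (U := C_UniformSpace) g1 t) ->
  (forall t, is_derive psi t (psi1 t)) -> (forall t, continuous psi1 t) ->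
  psi l = 0 -> psi m = 0 ->
  pairing l m g1 psi = Copp (pairing l m g psi1).
Proof.
  intros Hg Hg1 Hp Hp1 Hl Hm.
  assert (Hpc : forall t, continuous psi t).
  { intros t. apply (ex_derive_continuous (K := R_AbsRing) (V := R_NormedModule)).
    eexists; apply Hp. }
  assert (B : forall h h1 : R -> R, (forall t, l <= t <= m -> is_derive h t (h1 t)) ->
     (forall t, l <= t <= m -> continuous h1 t) ->
     RInt (fun t => h1 t * psi t) l m = - RInt (fun t => h t * psi1 t) l m).
  { intros h h1 Hh Hh1.
    assert (Hhc : forall t, l <= t <= m -> continuous h t).
    { intros t Ht. apply (ex_derive_continuous (K := R_AbsRing) (V := R_NormedModule)).
      eexists; now apply Hh. }
    assert (D : is_RInt (fun t => 1 * (h1 t * psi t) + 1 * (h t * psi1 t)) l m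
                  (minus (h m * psi m) (h l * psi l))).
    { apply (is_RInt_derive (V := R_CompleteNormedModule) (fun t => h t * psi t));
        rewrite Rmin_left, Rmax_right by lra.
      - intros t Ht. rewrite !Rmult_1_l. apply Derive.is_derive_mult; auto.
      - intros t Ht. apply (continuous_plus (V := R_NormedModule));
          apply (continuous_scal_r (V := R_NormedModule));
          apply (continuous_mult (K := R_AbsRing)); auto. }
    apply (is_RInt_unique (V := R_CompleteNormedModule)) in D.
    rewrite (RInt_ext_between _ (fun t => plus (h1 t * psi t) (h t * psi1 t))) in D
      by (intros; unfold plus; cbn -[RInt]; ring).
    rewrite (RInt_plus (V := R_CompleteNormedModule)) in D by now apply ex_RInt_mult_between.
    unfold minus, plus, opp in D; cbn -[RInt] in D. rewrite Hl, Hm in D. lra. }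
  unfold pairing, Copp; cbn [fst snd]. f_equal; apply B.
  - intros t Ht; apply is_cderive_iff, (Hg t Ht).
  - intros; now apply continuous_Re, Hg1.
  - intros t Ht; apply (proj2 (proj1 (is_cderive_iff _ _ _) (Hg t Ht))).
  - intros; now apply continuous_Im, Hg1.
Qed.

(** Recovers a value from a weighted mean: [z] times the total mass is the pairing of [h] minus the
    pairing of [h - z], and the latter is small when [h] stays near [z]. *)
Lemma Cmod_le_of_pairing (h : R -> C) (z : C) (psi : R -> R) (eps : R) :
  (forall t, l <= t <= m -> continuous (U := C_UniformSpace) h t) ->
  (forall t, continuous psi t) ->
  (forall t, l <= t <= m -> 0 <= psi t) ->
  (forall t, l <= t <= m -> Cmod (h t - z) <= eps) ->
  0 < RInt psi l m ->
  Cmod z <= 2 * eps + Cmod (pairing l m h psi) / RInt psi l m.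
Proof.
  intros Hh Hp Hp0 He HJ.
  set (J := RInt psi l m) in *.
  assert (Hc : forall t, l <= t <= m -> continuous (U := C_UniformSpace) (fun _ => z) t).
  { intros; apply continuous_const. }
  assert (E : (z * J)%C = (pairing l m h psi - pairing l m (fun t => 1 * h t + (- (1)) * z)%C psi)%C).
  { rewrite (pairing_linear 1%C (- (1))%C h (fun _ => z)) by auto.
    rewrite pairing_const by assumption. fold J. ring. }
  assert (B : Cmod (pairing l m (fun t => 1 * h t + (- (1)) * z)%C psi) <= 2 * eps * J).
  { apply pairing_bound; auto.
    - intros t Ht. apply (continuous_plus (V := C_R_NormedModule) (fun t => (1 * h t)%C)).
      + apply (continuous_ext (T := R_UniformSpace) (U := C_UniformSpace) h); auto.
        intros; symmetry; apply Cmult_1_l.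
      + apply continuous_const.
    - intros t Ht. replace (1 * h t + - (1) * z)%C with (h t - z)%C by ring. auto.
    - intros t Ht; rewrite Rabs_pos_eq; [lra | auto]. }
  apply Rmult_le_reg_r with J; [assumption|].
  replace ((2 * eps + Cmod (pairing l m h psi) / J) * J)
    with (2 * eps * J + Cmod (pairing l m h psi)) by (field; lra).
  rewrite <- (Rabs_pos_eq J) at 1 by lra. rewrite <- Cmod_R, <- Cmod_mult, E.
  unfold Cminus; eapply Rle_trans; [apply Cmod_triangle|]. rewrite Cmod_opp; lra.
Qed.

End Pairing.

(** * Joint continuity of complex functions and differentiation under the integral *)

Definition jointly_continuous (v : R -> R -> C) (x t : R) : Prop :=
  continuity_2d_pt (fun x t => Re (v x t)) x t /\
  continuity_2d_pt (fun x t => Im (v x t)) x t.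

Lemma continuous2_jointly (v : R -> R -> C) (x t : R) :
  continuous2 v x t -> jointly_continuous v x t.
Proof.
  intros H; split; apply continuity_2d_pt_filterlim.
  - apply (continuous_comp (U := prod_UniformSpace R_UniformSpace R_UniformSpace)
      (V := C_UniformSpace) (fun p => v (fst p) (snd p)) fst (x, t)); [exact H|].
    destruct (v (fst (x, t)) (snd (x, t)));
      apply (continuous_fst (U := R_UniformSpace) (V := R_UniformSpace)).
  - apply (continuous_comp (U := prod_UniformSpace R_UniformSpace R_UniformSpace)
      (V := C_UniformSpace) (fun p => v (fst p) (snd p)) snd (x, t)); [exact H|].
    destruct (v (fst (x, t)) (snd (x, t)));
      apply (continuous_snd (U := R_UniformSpace) (V := R_UniformSpace)).
Qed.

Lemma continuous_of_Re_Im (g : R -> C) (t : R) :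
  continuous (fun s => Re (g s)) t -> continuous (fun s => Im (g s)) t ->
  continuous (U := C_UniformSpace) g t.
Proof.
  intros H1 H2.
  apply (filterlim_locally (U := C_UniformSpace)); intros eps.
  generalize (proj1 (filterlim_locally (U := R_UniformSpace) _ _) H1 eps)
             (proj1 (filterlim_locally (U := R_UniformSpace) _ _) H2 eps).
  intros A B. generalize (filter_and _ _ A B). apply filter_imp.
  intros s [Hs1 Hs2]; split; assumption.
Qed.

Lemma continuity_2d_pt_slice (g : R -> R -> R) (x t : R) :
  continuity_2d_pt g x t -> continuous (g x) t.
Proof.
  intros H. apply (filterlim_locally (U := R_UniformSpace)); intros eps.
  destruct (H eps) as [d Hd]. exists d; intros s Hs. apply Hd; [|exact Hs].
  rewrite Rminus_diag, Rabs_R0; apply cond_pos.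
Qed.

Lemma jointly_continuous_slice (v : R -> R -> C) (x t : R) :
  jointly_continuous v x t -> continuous (U := C_UniformSpace) (v x) t.
Proof.
  intros [H1 H2]; apply continuous_of_Re_Im;
    [exact (continuity_2d_pt_slice _ _ _ H1) | exact (continuity_2d_pt_slice _ _ _ H2)].
Qed.

Lemma jointly_continuous_of_partial (b tau : R) (v v1 : R -> R -> C) :
  (forall x t, -b < x < b -> Rabs t < tau -> is_cderive (fun y => v y t) x (v1 x t)) ->
  (forall x t, -b < x < b -> Rabs t < tau -> jointly_continuous v1 x t) ->
  (forall t, Rabs t < tau -> continuous (U := C_UniformSpace) (v 0) t) ->
  forall x t, -b < x < b -> Rabs t < tau -> jointly_continuous v x t.
Proof.
  intros Hd H1 H0 x t Hx Ht; split.
  - apply (continuity_2d_pt_of_partial b tau _ (fun x t => Re (v1 x t))); auto.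
    + intros y s Hy Hs; apply (proj1 (is_cderive_iff _ _ _) (Hd y s Hy Hs)).
    + intros y s Hy Hs; apply (H1 y s Hy Hs).
    + intros s Hs; apply (continuous_Re (v 0)), H0, Hs.
  - apply (continuity_2d_pt_of_partial b tau _ (fun x t => Im (v1 x t))); auto.
    + intros y s Hy Hs; apply (proj1 (is_cderive_iff _ _ _) (Hd y s Hy Hs)).
    + intros y s Hy Hs; apply (H1 y s Hy Hs).
    + intros s Hs; apply (continuous_Im (v 0)), H0, Hs.
Qed.

Lemma Rabs_lt_of_between (tau l m t : R) : - tau < l -> m < tau -> l <= t <= m -> Rabs t < tau.
Proof. intros; apply Rabs_def1; lra. Qed.

Lemma is_derive_RInt_weighted (b tau l m : R) (g g1 : R -> R -> R) (psi : R -> R) (x : R) :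
  l < m -> - tau < l -> m < tau ->
  (forall x t, -b < x < b -> Rabs t < tau -> is_derive (fun y => g y t) x (g1 x t)) ->
  (forall x t, -b < x < b -> Rabs t < tau -> continuity_2d_pt g1 x t) ->
  (forall x t, -b < x < b -> Rabs t < tau -> continuous (g x) t) ->
  (forall t, continuous psi t) ->
  -b < x < b ->
  is_derive (fun x => RInt (fun t => g x t * psi t) l m) x
            (RInt (fun t => g1 x t * psi t) l m).
Proof.
  intros Hlm Hl Hm Hd H1 Hg Hp Hx.
  assert (Hd' : forall y t, -b < y < b -> Rabs t < tau ->
            is_derive (fun z => g z t * psi t) y (g1 y t * psi t)).
  { intros y t Hy Ht. apply (is_derive_eq _ _ (g1 y t * psi t + g y t * 0)); [|ring].
    apply (Derive.is_derive_mult (fun z => g z t) (fun _ => psi t)); [now apply Hd|].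
    apply (is_derive_const (K := R_AbsRing) (V := R_NormedModule)). }
  replace (RInt (fun t => g1 x t * psi t) l m)
    with (RInt (fun t => Derive (fun u => g u t * psi t) x) l m).
  - apply (is_derive_RInt_param (fun x t => g x t * psi t)).
    + apply (locally_open_interval _ (-b) b); [assumption|]. intros y Hy t Ht.
      rewrite Rmin_left, Rmax_right in Ht by lra.
      eexists; apply Hd'; [assumption | now apply (Rabs_lt_of_between tau l m)].
    + intros t Ht. rewrite Rmin_left, Rmax_right in Ht by lra.
      assert (Ht' := Rabs_lt_of_between tau l m t Hl Hm Ht).
      (* [Derive] is known to agree with [g1] only inside the rectangle, so the identification is
         local; the radius below keeps [(u, v)] inside. *)
      apply (continuity_2d_pt_ext_loc (fun u v => g1 u v * psi v)).
      * assert (Hdel : 0 < Rmin (b - Rabs x) (tau - Rabs t)).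
        { apply Rmin_pos; [|lra]. assert (Rabs x < b) by (apply Rabs_def1; lra). lra. }
        exists (mkposreal _ Hdel); cbn; intros u v Hu Hv. symmetry. apply is_derive_unique, Hd'.
        -- apply Rabs_lt_between. replace u with (u - x + x) by ring.
           eapply Rle_lt_trans; [apply Rabs_triang|].
           assert (L := Rmin_l (b - Rabs x) (tau - Rabs t)). lra.
        -- replace v with (v - t + t) by ring.
           eapply Rle_lt_trans; [apply Rabs_triang|].
           assert (L := Rmin_r (b - Rabs x) (tau - Rabs t)). lra.
      * apply continuity_2d_pt_mult; [now apply H1|].
        apply (continuity_1d_2d_pt_comp psi (fun _ v => v)).
        -- apply continuity_pt_filterlim, Hp.
        -- apply continuity_2d_pt_id2.
    + apply (locally_open_interval _ (-b) b); [assumption|]. intros y Hy.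
      apply ex_RInt_mult_between; auto. intros t Ht.
      apply Hg; [assumption | now apply (Rabs_lt_of_between tau l m)].
  - apply RInt_ext_between; [assumption|]. intros t Ht.
    apply is_derive_unique, Hd'; [assumption | now apply (Rabs_lt_of_between tau l m)].
Qed.

Lemma is_cderive_pairing (b tau l m : R) (v v1 : R -> R -> C) (psi : R -> R) (x : R) :
  l < m -> - tau < l -> m < tau ->
  (forall x t, -b < x < b -> Rabs t < tau -> is_cderive (fun y => v y t) x (v1 x t)) ->
  (forall x t, -b < x < b -> Rabs t < tau -> jointly_continuous v1 x t) ->
  (forall x t, -b < x < b -> Rabs t < tau -> continuous (U := C_UniformSpace) (v x) t) ->
  (forall t, continuous psi t) ->
  -b < x < b ->
  is_cderive (fun x => pairing l m (v x) psi) x (pairing l m (v1 x) psi).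
Proof.
  intros Hlm Hl Hm Hd H1 Hv Hp Hx. apply is_cderive_iff; split.
  - apply (is_derive_RInt_weighted b tau l m (fun x t => Re (v x t)) (fun x t => Re (v1 x t)));
      auto.
    + intros y s Hy Hs; apply (proj1 (is_cderive_iff _ _ _) (Hd y s Hy Hs)).
    + intros y s Hy Hs; apply (H1 y s Hy Hs).
    + intros y s Hy Hs; apply (continuous_Re (v y)), Hv; assumption.
  - apply (is_derive_RInt_weighted b tau l m (fun x t => Im (v x t)) (fun x t => Im (v1 x t)));
      auto.
    + intros y s Hy Hs; apply (proj1 (is_cderive_iff _ _ _) (Hd y s Hy Hs)).
    + intros y s Hy Hs; apply (H1 y s Hy Hs).
    + intros y s Hy Hs; apply (continuous_Im (v y)), Hv; assumption.
Qed.

(** * The Cauchy problem *)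

(** Sums the first [m] terms and may be empty, whereas [sum_n] always contains the term of index
    [0]; the recursion on remainders starts from the empty sum. *)
Fixpoint csum (a : nat -> C) (m : nat) : C :=
  match m with
  | O => 0%C
  | S k => (csum a k + a k)%C
  end.

Lemma sum_n_csum (a : nat -> C) (n : nat) :
  sum_n (G := C_AbelianMonoid) a n = csum a (S n).
Proof.
  induction n as [|n IH].
  - rewrite sum_O. cbn. ring.
  - rewrite sum_Sn, IH. reflexivity.
Qed.

Lemma is_cderive_csum (a a1 : nat -> R -> C) (m : nat) (x : R) :
  (forall j, is_cderive (a j) x (a1 j x)) ->
  is_cderive (fun y => csum (fun j => a j y) m) x (csum (fun j => a1 j x) m).
Proof.
  intros H; induction m as [|m IH]; cbn.
  - apply is_cderive_const.
  - now apply is_cderive_plus.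
Qed.

(** The algebra of [L S_(i+1) = (S_i)_t] once paired with the weight: each term reproduces its
    predecessor, with the sign of an integration by parts, and the first one reproduces nothing. *)
Lemma csum_shift (z : C) (a c : nat -> C) (m : nat) :
  csum (fun j => z * a j + match j with O => 0 | S i => - c i end)%C (S m) =
  (z * csum a (S m) - csum c m)%C.
Proof.
  induction m as [|m IH]; [cbn; ring|].
  change (csum ?h (S (S m))) with (csum h (S m) + h (S m))%C. rewrite IH. cbn. ring.
Qed.

Lemma csum_geometric_tail (a : nat -> C) (A rho : R) (n p : nat) :
  0 <= A -> 0 <= rho < 1 -> (forall j, Cmod (a j) <= A * rho ^ j) ->
  Cmod (csum a (n + p) - csum a n) <= A * rho ^ n / (1 - rho).
Proof.
  intros HA Hr Ha.
  (* Induction on [p] needs the exact finite geometric sum; the bound without [p] would not be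
     inductive. *)
  apply Rle_trans with (A * (rho ^ n - rho ^ (n + p)) / (1 - rho)).
  - induction p as [|p IH].
    + rewrite Nat.add_0_r. unfold Cminus; rewrite Cplus_opp_r, Cmod_0. right; field; lra.
    + rewrite Nat.add_succ_r. cbn [csum pow].
      replace (csum a (n + p) + a (n + p)%nat - csum a n)%C
        with ((csum a (n + p) - csum a n) + a (n + p)%nat)%C by ring.
      eapply Rle_trans; [apply Cmod_triangle|].
      eapply Rle_trans; [apply Rplus_le_compat; [exact IH | apply Ha]|].
      right; field; lra.
  - unfold Rdiv. apply Rmult_le_compat_r; [left; apply Rinv_0_lt_compat; lra|].
    apply Rmult_le_compat_l; [assumption|].
    assert (0 <= rho ^ (n + p)) by (apply pow_le; lra). lra.
Qed.

(** Only the middle half of the interval is kept. Its length is [w], and there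
    [w^2 - s^2 >= 3 w^2 / 4], which exceeds [w^2 / 2]. *)
Lemma RInt_bump_ge (w t0 : R) (n : nat) :
  0 < w -> w * (w ^ 2 / 2) ^ n <= RInt (fun t => bump_deriv w n 0 (t - t0)) (t0 - w) (t0 + w).
Proof.
  intros Hw. set (h := fun t => bump_deriv w n 0 (t - t0)).
  assert (Hc : forall t, continuous h t).
  { intros t. apply (continuous_comp (fun t => t - t0) (bump_deriv w n 0)).
    - apply (continuous_minus (V := R_NormedModule) (fun t => t) (fun _ => t0));
        [apply continuous_id | apply continuous_const].
    - apply continuous_bump_deriv. }
  assert (Hex : forall a c, ex_RInt h a c).
  { intros a c; apply (ex_RInt_continuous (V := R_CompleteNormedModule)); auto. }
  assert (Hp : forall t, t0 - w <= t <= t0 + w -> 0 <= h t).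
  { intros t Ht; unfold h; rewrite bump_deriv_0. apply pow_le. nra. }
  rewrite <- (RInt_Chasles (V := R_CompleteNormedModule) h (t0 - w) (t0 - w / 2) (t0 + w)) by auto.
  rewrite <- (RInt_Chasles (V := R_CompleteNormedModule) h (t0 - w / 2) (t0 + w / 2) (t0 + w)) by auto.
  assert (I1 : 0 <= RInt h (t0 - w) (t0 - w / 2)).
  { apply RInt_ge_0; [lra | auto | intros t Ht; apply Hp; lra]. }
  assert (I3 : 0 <= RInt h (t0 + w / 2) (t0 + w)).
  { apply RInt_ge_0; [lra | auto | intros t Ht; apply Hp; lra]. }
  assert (I2 : RInt (fun _ => (w ^ 2 / 2) ^ n) (t0 - w / 2) (t0 + w / 2) <= RInt h (t0 - w / 2) (t0 + w / 2)).
  { apply RInt_le; [lra | apply ex_RInt_const | auto |].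
    intros t Ht. unfold h; rewrite bump_deriv_0. apply pow_incr. nra. }
  rewrite RInt_const in I2. unfold scal in I2; cbn -[RInt pow] in I2. unfold mult in I2; cbn -[RInt pow] in I2.
  replace (t0 + w / 2 - (t0 - w / 2)) with w in I2 by field.
  unfold plus; cbn -[RInt pow]. lra.
Qed.

(** Used as [n! / (2n)! <= 1 / n!], the factorial surplus that beats every geometric factor. *)
Lemma fact_double_ge (n : nat) : (fact n * fact n <= fact (2 * n))%nat.
Proof.
  induction n as [|n IH]; [cbn; lia|].
  replace (2 * S n)%nat with (S (S (2 * n))) by lia.
  rewrite !fact_simpl. nia.
Qed.

Section Cauchy.

Variables (b tau K : R) (q f : R -> C) (alpha : C) (F G : R -> C) (u : R -> R -> C).
Hypothesis Hb : 0 < b.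
Hypothesis (Hf : nonvanishing_solution b q f) (Hf0 : f 0 = 1%C) (Halpha : CDerive f 0 = alpha).
Hypothesis (HF : Holmgren b tau K 0 F) (HG : Holmgren b tau K 0 G).
Hypothesis Hu : classical_Cauchy_solution b tau q F G u.

(** * Normalized powers and the coefficient functions of the data *)

Definition normalized_power (k : nat) (x : R) : C := (formal_power f k x / INR (fact k))%C.
Definition normalized_power_d1 (k : nat) (x : R) : C := (formal_power_d1 f k x / INR (fact k))%C.

Lemma INR_fact_C_neq_0 (k : nat) : RtoC (INR (fact k)) <> 0%C.
Proof. intros E; apply (INR_fact_neq_0 k). now inversion E. Qed.

Lemma INR_S_C_neq_0 (k : nat) : RtoC (INR (S k)) <> 0%C.
Proof. intros E; apply (not_0_INR (S k)); [lia|]. now inversion E. Qed.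

Lemma fact_S_C (k : nat) : RtoC (INR (fact (S k))) = (INR (S k) * INR (fact k))%C.
Proof. rewrite <- RtoC_mult, <- mult_INR. reflexivity. Qed.

Lemma is_cderive_normalized_power (k : nat) (x : R) :
  -b < x < b -> is_cderive (normalized_power k) x (normalized_power_d1 k x).
Proof.
  intros Hx. eapply is_cderive_eq.
  - apply is_cderive_mult; [now apply (is_cderive_formal_power b q f Hf) | apply is_cderive_const].
  - unfold normalized_power_d1, Cdiv; ring.
Qed.

Lemma is_cderive_normalized_power_d1 (k : nat) (x : R) :
  -b < x < b ->
  is_cderive (normalized_power_d1 k) x
    (Cplus (Cmult (q x) (normalized_power k x))
           (match k with S (S i) => normalized_power i x | _ => RtoC 0 end)).
Proof.
  intros Hx. eapply is_cderive_eq.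
  - apply is_cderive_mult; [now apply (is_cderive_formal_power_d1 b q f Hf) | apply is_cderive_const].
  - unfold normalized_power, Cdiv. destruct k as [|[|k]].
    + cbn [INR]. rewrite Rmult_0_l. ring.
    + cbn [INR Nat.sub]. rewrite Rmult_0_r. ring.
    + replace (S (S k) - 2)%nat with k by lia. replace (S (S k) - 1)%nat with (S k) by lia.
      rewrite RtoC_mult, !fact_S_C.
      assert (N0 := INR_fact_C_neq_0 k). assert (N1 := INR_S_C_neq_0 k).
      assert (N2 := INR_S_C_neq_0 (S k)). field; auto.
Qed.

(** These are adapted to the Cauchy data at [0]: [coefF 0] has data [(1, 0)], [coefG 0] has data
    [(0, 1)], and all later ones have zero data. The correction by [alpha] cancels the slope [f' 0]
    of the formal power of order [0]. *)
Definition coefF (j : nat) (x : R) : C :=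
  (normalized_power (2 * j) x - alpha * normalized_power (S (2 * j)) x)%C.
Definition coefG (j : nat) (x : R) : C := normalized_power (S (2 * j)) x.
Definition coefF_d1 (j : nat) (x : R) : C :=
  (normalized_power_d1 (2 * j) x - alpha * normalized_power_d1 (S (2 * j)) x)%C.
Definition coefG_d1 (j : nat) (x : R) : C := normalized_power_d1 (S (2 * j)) x.

Lemma series_term_coef (j : nat) (x t : R) :
  series_term f alpha F G j x t =
  (CDerive_n F j t * coefF j x + CDerive_n G j t * coefG j x)%C.
Proof.
  unfold series_term, coefF, coefG, normalized_power.
  replace (2 * j + 1)%nat with (S (2 * j)) by lia.
  rewrite fact_S_C. assert (N0 := INR_fact_C_neq_0 (2 * j)). assert (N1 := INR_S_C_neq_0 (2 * j)).
  field; auto.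
Qed.

Lemma is_cderive_coefF (j : nat) (x : R) :
  -b < x < b -> is_cderive (coefF j) x (coefF_d1 j x).
Proof.
  intros Hx. eapply is_cderive_eq.
  - apply is_cderive_minus; [now apply is_cderive_normalized_power|].
    apply is_cderive_mult; [apply is_cderive_const | now apply is_cderive_normalized_power].
  - unfold coefF_d1; cbn beta; ring.
Qed.

Lemma is_cderive_coefF_d1 (j : nat) (x : R) :
  -b < x < b ->
  is_cderive (coefF_d1 j) x
    (Cplus (Cmult (q x) (coefF j x)) (match j with O => RtoC 0 | S i => coefF i x end)).
Proof.
  intros Hx. eapply is_cderive_eq.
  - apply is_cderive_minus; [now apply is_cderive_normalized_power_d1|].
    apply is_cderive_mult; [apply is_cderive_const | now apply is_cderive_normalized_power_d1].
  - destruct j as [|j]; [unfold coefF; cbn -[normalized_power]; ring|].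
    unfold coefF. replace (2 * S j)%nat with (S (S (2 * j))) by lia. ring.
Qed.

Lemma is_cderive_coefG (j : nat) (x : R) :
  -b < x < b -> is_cderive (coefG j) x (coefG_d1 j x).
Proof. apply is_cderive_normalized_power. Qed.

Lemma is_cderive_coefG_d1 (j : nat) (x : R) :
  -b < x < b ->
  is_cderive (coefG_d1 j) x
    (Cplus (Cmult (q x) (coefG j x)) (match j with O => RtoC 0 | S i => coefG i x end)).
Proof.
  intros Hx. eapply is_cderive_eq.
  - now apply is_cderive_normalized_power_d1.
  - destruct j as [|j]; [reflexivity|].
    unfold coefG. replace (2 * S j)%nat with (S (S (2 * j))) by lia. reflexivity.
Qed.

Lemma coef_at_0 (j : nat) :
  coefF j 0 = match j with O => RtoC 1 | S _ => RtoC 0 end /\ coefG j 0 = RtoC 0.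
Proof.
  unfold coefF, coefG, normalized_power; split.
  - destruct j as [|j].
    + rewrite formal_power_at_0. change (2 * 0)%nat with 0%nat.
      rewrite (formal_power_0_at_0 f Hf0). cbn. field.
    + replace (2 * S j)%nat with (S (S (2 * j))) by lia. rewrite !formal_power_at_0.
      unfold Cdiv; ring.
  - rewrite formal_power_at_0. unfold Cdiv; ring.
Qed.

Lemma coef_d1_at_0 (j : nat) :
  coefF_d1 j 0 = RtoC 0 /\ coefG_d1 j 0 = match j with O => RtoC 1 | S _ => RtoC 0 end.
Proof.
  unfold coefF_d1, coefG_d1, normalized_power_d1; destruct j as [|j].
  - change (2 * 0)%nat with 0%nat. rewrite formal_power_d1_0_at_0, (formal_power_d1_1_at_0 f Hf0), Halpha.
    split; cbn; field.
  - replace (2 * S j)%nat with (S (S (2 * j))) by lia.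
    rewrite !(formal_power_d1_at_0 f Hf0). unfold Cdiv; split; ring.
Qed.

(** * Regularity of the data and of the solution *)

Lemma is_cderive_Holmgren (v : R -> C) (j : nat) (t : R) :
  Holmgren b tau K 0 v -> Rabs t < tau ->
  is_cderive (CDerive_n v j) t (CDerive_n v (S j) t).
Proof.
  intros Hv Ht. apply (is_cderive_CDerive (CDerive_n v j)), (Holmgren_smooth _ _ _ _ _ Hv).
  now rewrite Rminus_0_r.
Qed.

Lemma continuous_Holmgren (v : R -> C) (j : nat) (t : R) :
  Holmgren b tau K 0 v -> Rabs t < tau ->
  continuous (U := C_UniformSpace) (CDerive_n v j) t.
Proof. intros Hv Ht. eapply is_cderive_continuous, is_cderive_Holmgren; eassumption. Qed.

(** Continuity on the axis comes from the data: [u_x] equals [G] at [x = 0]. Continuity of [u_xx]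
    then spreads it over the rectangle. *)
Lemma jointly_continuous_d_x (x t : R) :
  -b < x < b -> Rabs t < tau -> jointly_continuous (d_x u) x t.
Proof.
  apply (jointly_continuous_of_partial b tau (d_x u) (d_xx u)).
  - intros y s Hy Hs. apply (is_cderive_CDerive (fun y => d_x u y s)), (ccs_dxx _ _ _ _ _ _ Hu); auto.
  - intros y s Hy Hs. apply continuous2_jointly, (ccs_dxx_cont _ _ _ _ _ _ Hu); auto.
  - intros s Hs. apply (continuous_ext_loc (U := C_UniformSpace) _ (CDerive_n G 0)).
    + apply Rabs_lt_between in Hs.
      apply (locally_open_interval _ (-tau) tau); [assumption|].
      intros y Hy. symmetry. apply (ccs_data1 _ _ _ _ _ _ Hu). now apply Rabs_lt_between.
    + now apply continuous_Holmgren.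
Qed.

Lemma is_cderive_u_x (x t : R) :
  -b < x < b -> Rabs t < tau -> is_cderive (fun y => u y t) x (d_x u x t).
Proof.
  intros Hx Ht. apply (is_cderive_CDerive (fun y => u y t)), (ccs_dx _ _ _ _ _ _ Hu); auto.
Qed.

Lemma is_cderive_u_t (x t : R) :
  -b < x < b -> Rabs t < tau -> is_cderive (u x) t (d_t u x t).
Proof.
  intros Hx Ht. apply (is_cderive_CDerive (fun s => u x s)), (ccs_dt _ _ _ _ _ _ Hu); auto.
Qed.

Lemma continuous_u_t (x t : R) :
  -b < x < b -> Rabs t < tau -> continuous (U := C_UniformSpace) (u x) t.
Proof. intros; eapply is_cderive_continuous, is_cderive_u_t; assumption. Qed.

Lemma jointly_continuous_u (x t : R) :
  -b < x < b -> Rabs t < tau -> jointly_continuous u x t.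
Proof.
  apply (jointly_continuous_of_partial b tau u (d_x u)).
  - exact is_cderive_u_x.
  - exact jointly_continuous_d_x.
  - intros s Hs; apply continuous_u_t; [lra | assumption].
Qed.

(** * Remainders paired with derivatives of a weight *)

Section Remainder.

(** [psi] is the sequence of derivatives of a test function on [l, m]
    vanishing to order [n] at both endpoints. *)
Variables (l m : R) (n : nat) (psi : nat -> R -> R).
Hypothesis (Hlm : l < m) (Hl : - tau < l) (Hm : m < tau).
Hypothesis Hpsi : forall k t, is_derive (psi k) t (psi (S k) t).
Hypothesis Hpsi0 : forall k, (k < n)%nat -> psi k l = 0 /\ psi k m = 0.

Let in_range (t : R) (Ht : l <= t <= m) : Rabs t < tau := Rabs_lt_of_between tau l m t Hl Hm Ht.

Lemma continuous_psi (k : nat) (t : R) : continuous (psi k) t.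
Proof.
  apply (ex_derive_continuous (K := R_AbsRing) (V := R_NormedModule)). eexists; apply Hpsi.
Qed.

Definition weighted_term (j k : nat) (x : R) : C :=
  (pairing l m (CDerive_n F j) (psi k) * coefF j x
   + pairing l m (CDerive_n G j) (psi k) * coefG j x)%C.
Definition weighted_term_d1 (j k : nat) (x : R) : C :=
  (pairing l m (CDerive_n F j) (psi k) * coefF_d1 j x
   + pairing l m (CDerive_n G j) (psi k) * coefG_d1 j x)%C.

Definition weighted_remainder (i : nat) (x : R) : C :=
  (pairing l m (u x) (psi (n - i)) - csum (fun j => weighted_term j (n - i) x) i)%C.
Definition weighted_remainder_d1 (i : nat) (x : R) : C :=
  (pairing l m (d_x u x) (psi (n - i)) - csum (fun j => weighted_term_d1 j (n - i) x) i)%C.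

Lemma is_cderive_weighted_term (j k : nat) (x : R) :
  -b < x < b -> is_cderive (weighted_term j k) x (weighted_term_d1 j k x).
Proof.
  intros Hx. eapply is_cderive_eq.
  - apply is_cderive_plus.
    + apply is_cderive_mult; [apply is_cderive_const | now apply is_cderive_coefF].
    + apply is_cderive_mult; [apply is_cderive_const | now apply is_cderive_coefG].
  - unfold weighted_term_d1; cbn beta; ring.
Qed.

Lemma pairing_Holmgren_by_parts (v : R -> C) (j k : nat) :
  Holmgren b tau K 0 v -> (k < n)%nat ->
  pairing l m (CDerive_n v (S j)) (psi k) = Copp (pairing l m (CDerive_n v j) (psi (S k))).
Proof.
  intros Hv Hk. apply pairing_by_parts; try assumption; try apply (Hpsi0 k Hk).
  - intros t Ht; apply is_cderive_Holmgren; [assumption | now apply in_range].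
  - intros t Ht; apply continuous_Holmgren; [assumption | now apply in_range].
  - apply Hpsi.
  - apply continuous_psi.
Qed.

(** For [j = S i] the source is [coefF i] and [coefG i] multiplied by pairings of the data of order
    [S i]. One integration by parts brings these back to order [i] at the cost of one derivative of
    the weight, which gives minus the term [i]. *)
Lemma is_cderive_weighted_term_d1 (j k : nat) (x : R) :
  -b < x < b -> (k < n)%nat ->
  is_cderive (weighted_term_d1 j k) x
    (Cplus (Cmult (q x) (weighted_term j k x))
       (match j with O => RtoC 0 | S i => Copp (weighted_term i (S k) x) end)).
Proof.
  intros Hx Hk. eapply is_cderive_eq.
  - apply is_cderive_plus.
    + apply is_cderive_mult; [apply is_cderive_const | now apply is_cderive_coefF_d1].
    + apply is_cderive_mult; [apply is_cderive_const | now apply is_cderive_coefG_d1].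
  - unfold weighted_term. destruct j as [|j]; [ring|].
    rewrite !pairing_Holmgren_by_parts by assumption. ring.
Qed.

Lemma is_cderive_weighted_remainder (i : nat) (x : R) :
  -b < x < b -> is_cderive (weighted_remainder i) x (weighted_remainder_d1 i x).
Proof.
  intros Hx. apply is_cderive_minus.
  - apply (is_cderive_pairing b tau); auto.
    + exact is_cderive_u_x.
    + exact jointly_continuous_d_x.
    + exact continuous_u_t.
    + apply continuous_psi.
  - apply (is_cderive_csum (fun j => weighted_term j (n - i)) (fun j => weighted_term_d1 j (n - i))).
    intros j; now apply is_cderive_weighted_term.
Qed.

(** The partial differential equation enters here: [u_xx] becomes [q u + u_t], and the time
    derivative passes to the weight. *)
Lemma pairing_d_xx (k : nat) (x : R) :
  -b < x < b -> (k < n)%nat ->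
  pairing l m (d_xx u x) (psi k) =
  (q x * pairing l m (u x) (psi k) - pairing l m (u x) (psi (S k)))%C.
Proof.
  intros Hx Hk.
  assert (Hdt : forall t, l <= t <= m -> continuous (U := C_UniformSpace) (d_t u x) t).
  { intros t Ht. apply jointly_continuous_slice, continuous2_jointly, (ccs_dt_cont _ _ _ _ _ _ Hu);
      [assumption | now apply in_range]. }
  rewrite (pairing_ext l m Hlm _ (fun t => q x * u x t + 1 * d_t u x t)%C).
  - rewrite pairing_linear; auto using continuous_psi.
    + rewrite (pairing_by_parts l m Hlm (u x) (d_t u x) (psi k) (psi (S k)));
        auto using continuous_psi; try apply (Hpsi0 k Hk); [ring|].
      intros t Ht; apply is_cderive_u_t; [assumption | now apply in_range].
    + intros t Ht; apply continuous_u_t; [assumption | now apply in_range].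
  - intros t Ht. rewrite <- (ccs_eq _ _ _ _ _ _ Hu x t) by auto. ring.
Qed.

Lemma is_cderive_weighted_remainder_d1 (i : nat) (x : R) :
  -b < x < b -> (i < n)%nat ->
  is_cderive (weighted_remainder_d1 (S i)) x
    (Cplus (Cmult (q x) (weighted_remainder (S i) x)) (Copp (weighted_remainder i x))).
Proof.
  intros Hx Hi. set (k := (n - S i)%nat). assert (Hk : (n - i)%nat = S k) by lia.
  eapply is_cderive_eq.
  - apply is_cderive_minus.
    + apply (is_cderive_pairing b tau l m (d_x u) (d_xx u)); auto using continuous_psi.
      * intros y s Hy Hs.
        apply (is_cderive_CDerive (fun y => d_x u y s)), (ccs_dxx _ _ _ _ _ _ Hu); auto.
      * intros y s Hy Hs. apply continuous2_jointly, (ccs_dxx_cont _ _ _ _ _ _ Hu); auto.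
      * intros y s Hy Hs. now apply jointly_continuous_slice, jointly_continuous_d_x.
    + apply (is_cderive_csum (fun j => weighted_term_d1 j k)
        (fun j x => q x * weighted_term j k x
                    + match j with O => 0 | S i => - weighted_term i (S k) x end)%C).
      intros j; apply is_cderive_weighted_term_d1; [assumption | lia].
  - cbn beta. rewrite (csum_shift (q x) (fun j => weighted_term j k x) (fun j => weighted_term j (S k) x)).
    unfold weighted_remainder. rewrite Hk. fold k. rewrite pairing_d_xx by (assumption || lia). ring.
Qed.

Lemma weighted_remainder_at_0 (i : nat) : weighted_remainder (S i) 0 = RtoC 0.
Proof.
  unfold weighted_remainder. set (k := (n - S i)%nat).
  assert (E : csum (fun j => weighted_term j k 0) (S i) = pairing l m F (psi k)).
  (* The index [k] was defined from [i]; forgetting its value keeps the weight fixed during the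
     induction on the number of terms. *)
  { clearbody k; induction i as [|i IH].
    - cbn [csum]. unfold weighted_term. destruct (coef_at_0 0) as [-> ->]. change (CDerive_n F 0) with F; change (CDerive_n G 0) with G; ring.
    - change (csum ?h (S (S i))) with (csum h (S i) + h (S i))%C. rewrite IH.
      unfold weighted_term. destruct (coef_at_0 (S i)) as [-> ->]. ring. }
  rewrite E, (pairing_ext l m Hlm (u 0) F); [ring|].
  intros t Ht; apply (ccs_data0 _ _ _ _ _ _ Hu); auto.
Qed.

Lemma weighted_remainder_d1_at_0 (i : nat) : weighted_remainder_d1 (S i) 0 = RtoC 0.
Proof.
  unfold weighted_remainder_d1. set (k := (n - S i)%nat).
  assert (E : csum (fun j => weighted_term_d1 j k 0) (S i) = pairing l m G (psi k)).
  { clearbody k; induction i as [|i IH].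
    - cbn [csum]. unfold weighted_term_d1. destruct (coef_d1_at_0 0) as [-> ->]. change (CDerive_n F 0) with F; change (CDerive_n G 0) with G; ring.
    - change (csum ?h (S (S i))) with (csum h (S i) + h (S i))%C. rewrite IH.
      unfold weighted_term_d1. destruct (coef_d1_at_0 (S i)) as [-> ->]. ring. }
  rewrite E, (pairing_ext l m Hlm (d_x u 0) G); [ring|].
  intros t Ht; apply (ccs_data1 _ _ _ _ _ _ Hu); auto.
Qed.

(** Each step applies [pow_exp_majorant] with exponent [2 (i + 1)]: its factor [(2i + 2) (2i + 1)]
    turns [D / (2i + 2)!] into exactly [D / (2i)!], the bound on the source. The base case uses only
    [exp (c |s|) >= 1]. *)
Lemma weighted_remainder_bound (D c Q r : R) (i : nat) :
  0 <= D -> 0 <= Q -> 1 <= c -> Q <= c -> 0 < r < b -> (i <= n)%nat ->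
  (forall s, -r <= s <= r -> Cmod (q s) <= Q) ->
  (forall s, -r <= s <= r -> Cmod (pairing l m (u s) (psi n)) <= D) ->
  forall s, -r <= s <= r ->
  Cmod (weighted_remainder i s) <= D / INR (fact (2 * i)) * (Rabs s ^ (2 * i) * exp (c * Rabs s)).
Proof.
  intros HD HQ Hc HcQ Hr Hi Hq HDb. induction i as [|i IH].
  - intros s Hs. unfold weighted_remainder. rewrite Nat.sub_0_r. change (2 * 0)%nat with 0%nat. cbn [csum pow fact INR].
    unfold Cminus. rewrite Copp_0, Cplus_0_r.
    replace (D / 1 * (1 * exp (c * Rabs s))) with (D * exp (c * Rabs s)) by field.
    rewrite <- (Rmult_1_r (Cmod _)).
    apply Rmult_le_compat; [apply Cmod_ge_0 | lra | now apply HDb|].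
    eapply Rle_trans; [|apply exp_ineq1_le].
    assert (0 <= c * Rabs s) by (apply Rmult_le_pos; [lra | apply Rabs_pos]). lra.
  - specialize (IH ltac:(lia)).
    apply (pow_exp_majorant (weighted_remainder (S i)) (weighted_remainder_d1 (S i)) q
             (fun s => Copp (weighted_remainder i s)) _ c Q r (2 * S i)); auto; try lra.
    + apply Rmult_le_pos; [assumption | left; apply Rinv_0_lt_compat, INR_fact_lt_0].
    + intros s Hs; apply is_cderive_weighted_remainder; lra.
    + intros s Hs; apply is_cderive_weighted_remainder_d1; [lra | lia].
    + intros s Hs. rewrite Cmod_opp. eapply Rle_trans; [now apply IH|].
      replace (2 * S i)%nat with (S (S (2 * i))) by lia.
      replace (S (S (2 * i)) - 1)%nat with (S (2 * i)) by lia.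
      replace (S (S (2 * i)) - 2)%nat with (2 * i)%nat by lia.
      rewrite (fact_simpl (S (2 * i))), (fact_simpl (2 * i)), !mult_INR.
      right; field. repeat split; try apply not_0_INR; try lia; apply fact_neq_0.
    + rewrite weighted_remainder_at_0, Cmod_0.
      replace (2 * S i)%nat with (S (S (2 * i))) by lia. cbn [pow]. lra.
    + rewrite weighted_remainder_d1_at_0, Cmod_0.
      replace (2 * S i)%nat with (S (S (2 * i))) by lia. cbn [pow Nat.sub]. lra.
Qed.

Lemma continuous_series_term_t (j : nat) (x t : R) :
  Rabs t < tau -> continuous (U := C_UniformSpace) (series_term f alpha F G j x) t.
Proof.
  intros Ht. eapply is_cderive_continuous.
  apply (is_derive_ext (K := R_AbsRing) (V := C_R_NormedModule)
    (fun t => CDerive_n F j t * coefF j x + CDerive_n G j t * coefG j x)%C).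
  { intros s; symmetry; apply series_term_coef. }
  apply is_cderive_plus; (apply is_cderive_mult;
    [apply is_cderive_Holmgren; eassumption | apply is_cderive_const]).
Qed.

Lemma continuous_partial_sum_t (k : nat) (x t : R) :
  Rabs t < tau ->
  continuous (U := C_UniformSpace) (fun t => csum (fun j => series_term f alpha F G j x t) k) t.
Proof.
  intros Ht; induction k as [|k IH]; cbn [csum].
  - apply continuous_const.
  - apply (continuous_plus (V := C_R_NormedModule) _ (series_term f alpha F G k x));
      [exact IH | now apply continuous_series_term_t].
Qed.

(** At the last stage the weight carries no derivative, so a bound on this remainder is a bound on
    the weighted mean of [u - S_n] itself. *)
Lemma weighted_remainder_full (x : R) :
  -b < x < b ->
  weighted_remainder n x =
  pairing l m (fun t => u x t - csum (fun j => series_term f alpha F G j x t) n)%C (psi 0%nat).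
Proof.
  intros Hx.
  rewrite (pairing_ext l m Hlm (fun t => u x t - _)%C
    (fun t => 1 * u x t + (- (1)) * csum (fun j => series_term f alpha F G j x t) n)%C)
    by (intros; ring).
  rewrite pairing_linear; auto using continuous_psi.
  2:{ intros t Ht; apply continuous_u_t; [assumption | now apply in_range]. }
  2:{ intros t Ht; apply continuous_partial_sum_t; now apply in_range. }
  unfold weighted_remainder. rewrite Nat.sub_diag.
  enough (E : forall k, csum (fun j => weighted_term j 0 x) k =
    pairing l m (fun t => csum (fun j => series_term f alpha F G j x t) k) (psi 0%nat))
    by (rewrite E; ring).
  induction k as [|k IH]; cbn [csum].
  - rewrite pairing_const by (assumption || apply continuous_psi). ring.
  - rewrite IH.
    rewrite (pairing_ext l m Hlm (fun t => _ + _)%C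
      (fun t => 1 * csum (fun j => series_term f alpha F G j x t) k
                + 1 * series_term f alpha F G k x t)%C) by (intros; ring).
    rewrite pairing_linear; auto using continuous_psi.
    2:{ intros t Ht; apply continuous_partial_sum_t; now apply in_range. }
    2:{ intros t Ht; apply continuous_series_term_t; now apply in_range. }
    rewrite (pairing_ext l m Hlm (series_term f alpha F G k x)
      (fun t => coefF k x * CDerive_n F k t + coefG k x * CDerive_n G k t)%C)
      by (intros; rewrite series_term_coef; ring).
    rewrite pairing_linear; auto using continuous_psi.
    + unfold weighted_term. ring.
    + intros t Ht; apply continuous_Holmgren; [assumption | now apply in_range].
    + intros t Ht; apply continuous_Holmgren; [assumption | now apply in_range].
Qed.

End Remainder.

(** * Geometric majorant of the terms and identification of the sum *)

(** The [(2j)!] of the Holmgren bound cancels the one in the normalized power, leaving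
    [(r / b)^(2j)]. In [1 + |alpha| r + r] the summands come from the even power, its odd correction
    and the term in [G]; the surplus factor of [(2j + 1)!] is discarded. *)
Lemma series_term_bound (c r : R) :
  0 <= c -> 0 < r < b -> 0 < K ->
  (forall k s, -r <= s <= r -> Cmod (formal_power f k s) <= Rabs s ^ k * exp (c * Rabs s)) ->
  forall j x t, Rabs x <= r -> Rabs t < tau ->
  Cmod (series_term f alpha F G j x t) <=
  K * exp (c * r) * (1 + Cmod alpha * r + r) * ((r / b) ^ 2) ^ j.
Proof.
  intros Hc Hr HK Hp j x t Hx Ht.
  set (e := exp (c * r)). assert (He : 0 < e) by apply exp_pos.
  assert (Hk : forall k, Cmod (formal_power f k x) <= r ^ k * e).
  { intros k. eapply Rle_trans; [apply Hp; now apply Rabs_le_between|].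
    apply Rmult_le_compat; [apply pow_le, Rabs_pos | left; apply exp_pos | |].
    - apply pow_incr; split; [apply Rabs_pos | assumption].
    - destruct (Rle_lt_or_eq_dec (c * Rabs x) (c * r)) as [L|L].
      + now apply Rmult_le_compat_l.
      + left; now apply exp_increasing.
      + rewrite L; apply Rle_refl. }
  assert (HFj := Holmgren_bound _ _ _ _ _ HF j t ltac:(now rewrite Rminus_0_r)).
  assert (HGj := Holmgren_bound _ _ _ _ _ HG j t ltac:(now rewrite Rminus_0_r)).
  set (N := (2 * j)%nat) in *.
  assert (Hfa : 0 < INR (fact N)) by apply INR_fact_lt_0.
  assert (HbN : 0 < / b ^ N) by (apply Rinv_0_lt_compat, pow_lt; lra).
  assert (HrN : 0 < r ^ N) by (apply pow_lt; lra).
  assert (Hn : forall k, Cmod (normalized_power k x) <= r ^ k * e / INR (fact k)).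
  { intros k. unfold normalized_power. rewrite Cmod_div by apply INR_fact_C_neq_0.
    rewrite Cmod_R, Rabs_pos_eq by (left; apply INR_fact_lt_0).
    apply Rmult_le_compat_r; [left; apply Rinv_0_lt_compat, INR_fact_lt_0 | apply Hk]. }
  assert (HB : Cmod (coefG j x) <= r ^ N * r * e / INR (fact N)).
  { eapply Rle_trans; [apply Hn|]. fold N. cbn [pow].
    rewrite (Rmult_comm r). apply Rmult_le_compat_l.
    - repeat apply Rmult_le_pos; lra.
    - apply Rinv_le_contravar; [assumption|]. apply le_INR, fact_le; lia. }
  assert (HA : Cmod (coefF j x) <= r ^ N * e / INR (fact N) * (1 + Cmod alpha * r)).
  { unfold coefF. eapply Rle_trans; [apply Cmod_triangle|]. rewrite Cmod_opp, Cmod_mult.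
    eapply Rle_trans; [apply Rplus_le_compat; [apply Hn|
      apply Rmult_le_compat_l; [apply Cmod_ge_0 | exact HB]]|].
    fold N. right; field; lra. }
  rewrite series_term_coef. eapply Rle_trans; [apply Cmod_triangle|]. rewrite !Cmod_mult.
  eapply Rle_trans; [apply Rplus_le_compat; apply Rmult_le_compat; try apply Cmod_ge_0;
    [exact HFj | exact HA | exact HGj | exact HB]|].
  rewrite <- pow_mult. fold N. change (r / b) with (r * / b). rewrite Rpow_mult_distr, pow_inv.
  right; field. split; [apply pow_nonzero|]; lra.
Qed.

Let partial_sum (n : nat) (x t : R) : C := csum (fun j => series_term f alpha F G j x t) n.

(** What matters is the order of quantifiers: once [t0] and [w] are fixed, [A] and [B] depend
    neither on [n] nor on [x]. *)
Lemma bump_remainder_ratio (c Q r t0 w : R) :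
  0 <= Q -> 1 <= c -> Q <= c -> 0 < r < b ->
  (forall s, -r <= s <= r -> Cmod (q s) <= Q) ->
  0 < w <= 1 -> - tau < t0 - w -> t0 + w < tau ->
  exists A B, 0 <= A /\ forall n x, Rabs x <= r ->
  Cmod (pairing (t0 - w) (t0 + w) (fun t => u x t - partial_sum n x t)%C
          (fun t => bump_deriv w n 0 (t - t0)))
  / RInt (fun t => bump_deriv w n 0 (t - t0)) (t0 - w) (t0 + w) <= A * (B ^ n / INR (fact n)).
Proof.
  intros HQ Hc HcQ Hr Hq Hw Hl Hm.
  destruct (continuity_2d_pt_bounded (fun x t => Re (u x t)) (-r) r (t0 - w) (t0 + w)) as [M1 [HM1 HM1']].
  { intros x t Hx Ht. apply jointly_continuous_u; [lra|].
    now apply (Rabs_lt_of_between tau (t0 - w) (t0 + w)). }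
  destruct (continuity_2d_pt_bounded (fun x t => Im (u x t)) (-r) r (t0 - w) (t0 + w)) as [M2 [HM2 HM2']].
  { intros x t Hx Ht. apply jointly_continuous_u; [lra|].
    now apply (Rabs_lt_of_between tau (t0 - w) (t0 + w)). }
  set (M := M1 + M2).
  assert (HM : forall x t, -r <= x <= r -> t0 - w <= t <= t0 + w -> Cmod (u x t) <= M).
  { intros x t Hx Ht. eapply Rle_trans; [apply Cmod_le_Re_Im|]. unfold M.
    apply Rplus_le_compat; auto. }
  assert (HM0 : 0 <= M) by (unfold M; lra).
  set (e := exp (c * r)). assert (He : 0 < e) by apply exp_pos.
  (* In [A], the factor [2 M] of the pairing bound meets the interval length [2 w], and this [w]
     cancels the one in the lower bound of the mass. In [B], the [4] bounds the bump derivatives,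
     [r^2] comes from [r^(2n)], and [2 / w^2] from the mass. *)
  exists (4 * M * e), (8 * r ^ 2 / w ^ 2); split.
  { repeat apply Rmult_le_pos; lra. }
  intros n x Hx. apply Rabs_le_between in Hx.
  set (psi := fun k t => bump_deriv w n k (t - t0)).
  change (fun t => bump_deriv w n 0 (t - t0)) with (psi 0%nat).
  set (J := RInt (psi 0%nat) (t0 - w) (t0 + w)).
  assert (HJ : w * (w ^ 2 / 2) ^ n <= J) by (apply RInt_bump_ge; lra).
  assert (HJ0 : 0 < w * (w ^ 2 / 2) ^ n).
  { apply Rmult_lt_0_compat; [lra|]. apply pow_lt. assert (0 < w ^ 2) by (apply pow_lt; lra). lra. }
  assert (Hpsi : forall k t, is_derive (psi k) t (psi (S k) t)).
  { intros k t. unfold psi. eapply is_derive_eq.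
    - apply (is_derive_comp (bump_deriv w n k) (fun t => t - t0)).
      + apply is_derive_bump_deriv.
      + auto_derive; [exact I | reflexivity].
    - unfold scal; cbn -[bump_deriv]; unfold mult; cbn -[bump_deriv]; ring. }
  assert (Hpsi0 : forall k, (k < n)%nat -> psi k (t0 - w) = 0 /\ psi k (t0 + w) = 0).
  { intros k Hk; split; apply bump_deriv_endpoint; try assumption; ring. }
  assert (Hlm : t0 - w < t0 + w) by lra.
  assert (Hcont := continuous_psi psi Hpsi).
  unfold partial_sum.
  rewrite <- weighted_remainder_full with (n := n) by (assumption || lra).
  assert (HD : forall s, -r <= s <= r ->
     Cmod (pairing (t0 - w) (t0 + w) (u s) (psi n)) <= 4 * M * w * (4 ^ n * INR (fact n))).
  { intros s Hs. eapply Rle_trans.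
    - apply (pairing_bound (t0 - w) (t0 + w) Hlm (u s) (psi n) (fun _ => 4 ^ n * INR (fact n)) M); auto.
      + intros t Ht. apply continuous_u_t; [lra|].
        now apply (Rabs_lt_of_between tau (t0 - w) (t0 + w)).
      + intros t; apply continuous_const.
      + intros t Ht. apply bump_deriv_bound; lra.
    - rewrite RInt_const. unfold scal; cbn -[pow fact INR]. unfold mult; cbn -[pow fact INR].
      right; ring. }
  assert (HW := weighted_remainder_bound (t0 - w) (t0 + w) n psi Hlm Hl Hm Hpsi Hpsi0 (4 * M * w * (4 ^ n * INR (fact n))) c Q r n).
  assert (Hfn := INR_fact_lt_0 n). assert (Hf2 := INR_fact_lt_0 (2 * n)).
  assert (H4 : 0 < 4 ^ n) by (apply pow_lt; lra).
  assert (HD0 : 0 <= 4 * M * w * (4 ^ n * INR (fact n))) by (repeat apply Rmult_le_pos; lra).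
  specialize (HW HD0 HQ Hc HcQ Hr (le_n n) Hq HD x Hx).
  set (W := Cmod _) in HW |- *.
  assert (HW' : W <= 4 * M * w * (4 ^ n / INR (fact n)) * (r ^ (2 * n) * e)).
  { eapply Rle_trans; [exact HW|]. apply Rmult_le_compat.
    - apply Rmult_le_pos; [assumption | left; now apply Rinv_0_lt_compat].
    - apply Rmult_le_pos; [apply pow_le, Rabs_pos | left; apply exp_pos].
    - unfold Rdiv. rewrite !Rmult_assoc. do 3 (apply Rmult_le_compat_l; [lra|]).
      apply Rmult_le_compat_l; [lra|].
      apply Rmult_le_reg_r with (INR (fact (2 * n))); [assumption|].
      rewrite Rmult_assoc, Rinv_l, Rmult_1_r by lra.
      apply Rmult_le_reg_l with (INR (fact n)); [assumption|].
      rewrite <- Rmult_assoc, Rinv_r, Rmult_1_l by lra.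
      rewrite <- mult_INR. apply le_INR, fact_double_ge.
    - apply Rmult_le_compat; [apply pow_le, Rabs_pos | left; apply exp_pos | |].
      + apply pow_incr; split; [apply Rabs_pos | now apply Rabs_le].
      + assert (L : Rabs x <= r) by now apply Rabs_le.
        destruct (Rle_lt_or_eq_dec (c * Rabs x) (c * r)) as [E|E].
        * apply Rmult_le_compat_l; lra.
        * left; now apply exp_increasing.
        * rewrite E; apply Rle_refl. }
  assert (HW0 : 0 <= W) by apply Cmod_ge_0.
  apply Rle_trans with (W / (w * (w ^ 2 / 2) ^ n)).
  { apply Rmult_le_compat_l; [assumption|]. now apply Rinv_le_contravar. }
  apply Rle_div_l; [assumption|].
  eapply Rle_trans; [exact HW'|]. right.
  replace (8 * r ^ 2 / w ^ 2) with (4 * r ^ 2 * / (w ^ 2 / 2)) by (field; lra).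
  rewrite !Rpow_mult_distr, pow_inv, <- (pow_mult r).
  field. split; [|lra]. apply pow_nonzero. assert (0 < w ^ 2) by (apply pow_lt; lra). lra.
Qed.

(** The interval around [t0] is chosen from the continuity of [u - S_N] with [N] fixed. For every
    [n >= N], the function [u - S_n] then stays within [2 eps] of [z] on it, one [eps] coming from
    continuity and one from the geometric tail. Its weighted mean tends to [0], and the factor [2]
    of [Cmod_le_of_pairing] makes the final constant [4]. *)
Lemma partial_sum_close (c Q r A rho eps : R) (N : nat) :
  0 <= Q -> 1 <= c -> Q <= c -> 0 < r < b ->
  (forall s, -r <= s <= r -> Cmod (q s) <= Q) ->
  0 <= A -> 0 <= rho < 1 ->
  (forall j x t, Rabs x <= r -> Rabs t < tau ->
     Cmod (series_term f alpha F G j x t) <= A * rho ^ j) ->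
  0 < eps -> A * rho ^ N / (1 - rho) <= eps ->
  forall x t, Rabs x <= r -> Rabs t < tau ->
  Cmod (u x t - partial_sum N x t) <= 4 * eps.
Proof.
  intros HQ Hc HcQ Hr Hq HA Hrho Hterm Heps HN x t0 Hx Ht0.
  assert (Hxb : -b < x < b) by (apply Rabs_le_between in Hx; lra).
  assert (Hcont : forall n t, Rabs t < tau ->
     continuous (U := C_UniformSpace) (fun t => u x t - partial_sum n x t)%C t).
  { intros n t Ht. apply (continuous_minus (V := C_R_NormedModule) (u x) (partial_sum n x)).
    - now apply continuous_u_t.
    - apply (continuous_partial_sum_t n x t Ht). }
  set (z := (u x t0 - partial_sum N x t0)%C).
  assert (Hz : continuous (fun t => Cmod (u x t - partial_sum N x t - z)) t0).
  { apply continuous_Cmod_comp.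
    apply (continuous_minus (V := C_R_NormedModule) (fun t => u x t - partial_sum N x t)%C (fun _ => z)).
    - now apply Hcont.
    - apply continuous_const. }
  destruct (proj1 (filterlim_locally (U := R_UniformSpace) _ _) Hz (mkposreal _ Heps)) as [d Hd].
  assert (Hd' : forall t, Rabs (t - t0) < d -> Cmod (u x t - partial_sum N x t - z) < eps).
  { intros t Ht. specialize (Hd t Ht).
    change (Rabs (Cmod (u x t - partial_sum N x t - z) - Cmod (u x t0 - partial_sum N x t0 - z)) < eps) in Hd.
    fold z in Hd. unfold Cminus at 3 in Hd. rewrite Cplus_opp_r, Cmod_0, Rminus_0_r in Hd.
    eapply Rle_lt_trans; [apply Rle_abs | exact Hd]. }
  (* The three constraints serve the bump bound, the continuity at [t0], and the inclusion of the
     interval in [(-tau, tau)]; the halves make the last two strict. *)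
  set (w := Rmin 1 (Rmin (d / 2) ((tau - Rabs t0) / 2))).
  assert (L1 : w <= 1) by apply Rmin_l.
  assert (L2 : w <= d / 2) by (eapply Rle_trans; [apply Rmin_r | apply Rmin_l]).
  assert (L3 : w <= (tau - Rabs t0) / 2) by (eapply Rle_trans; [apply Rmin_r | apply Rmin_r]).
  assert (Hdp := cond_pos d).
  assert (L0 : 0 < w) by (unfold w; repeat apply Rmin_pos; lra).
  assert (T1 : - tau < t0 - w) by (unfold Rabs in *; destruct (Rcase_abs t0); lra).
  assert (T2 : t0 + w < tau) by (unfold Rabs in *; destruct (Rcase_abs t0); lra).
  destruct (bump_remainder_ratio c Q r t0 w) as [A' [B [HA' Hratio]]]; try assumption; [lra|].
  assert (Hall : forall n, (N <= n)%nat -> Cmod z <= 4 * eps + A' * (B ^ n / INR (fact n))).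
  { intros n Hn.
    assert (HJ : 0 < RInt (fun t => bump_deriv w n 0 (t - t0)) (t0 - w) (t0 + w)).
    { eapply Rlt_le_trans; [|now apply RInt_bump_ge].
      apply Rmult_lt_0_compat; [assumption|]. apply pow_lt.
      assert (0 < w ^ 2) by (apply pow_lt; lra). lra. }
    eapply Rle_trans.
    - apply (Cmod_le_of_pairing (t0 - w) (t0 + w)) with (h := fun t => (u x t - partial_sum n x t)%C)
        (psi := fun t => bump_deriv w n 0 (t - t0)) (eps := 2 * eps); [lra | | | | | exact HJ].
      + intros t Ht. apply Hcont. now apply (Rabs_lt_of_between tau (t0 - w) (t0 + w)).
      + intros t. apply (continuous_comp (fun t => t - t0) (bump_deriv w n 0)).
        * apply (continuous_minus (V := R_NormedModule) (fun t => t) (fun _ => t0));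
            [apply continuous_id | apply continuous_const].
        * apply continuous_bump_deriv.
      + intros t Ht. rewrite bump_deriv_0. apply pow_le. nra.
      + intros t Ht.
        assert (Ht' : Rabs t < tau) by now apply (Rabs_lt_of_between tau (t0 - w) (t0 + w)).
        replace (u x t - partial_sum n x t - z)%C
          with ((u x t - partial_sum N x t - z) + - (partial_sum n x t - partial_sum N x t))%C by ring.
        eapply Rle_trans; [apply Cmod_triangle|]. rewrite Cmod_opp.
        assert (Rabs (t - t0) < d) by (apply Rabs_def1; lra).
        assert (E := Hd' t ltac:(assumption)).
        replace n with (N + (n - N))%nat by lia.
        assert (E2 := csum_geometric_tail (fun j => series_term f alpha F G j x t) A rho N (n - N) HA Hrho
                  (fun j => Hterm j x t Hx Ht')).
        unfold partial_sum at 2 3. lra.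
    - assert (E := Hratio n x Hx). lra. }
  apply Rle_plus_epsilon; intros e He.
  destruct (cv_speed_pow_fact B (e / (A' + 1))) as [N1 HN1].
  { apply Rdiv_lt_0_compat; lra. }
  specialize (HN1 (max N N1) ltac:(lia)). specialize (Hall (max N N1) ltac:(lia)).
  unfold Rdist in HN1; rewrite Rminus_0_r in HN1.
  set (T := B ^ max N N1 / INR (fact (max N N1))) in *.
  assert (T <= e / (A' + 1)) by (left; eapply Rle_lt_trans; [apply Rle_abs | exact HN1]).
  assert (A' * T <= A' * (e / (A' + 1))) by (apply Rmult_le_compat_l; assumption).
  assert (A' * (e / (A' + 1)) <= e).
  { apply Rmult_le_reg_r with (A' + 1); [lra|].
    replace (A' * (e / (A' + 1)) * (A' + 1)) with (A' * e) by (field; lra). nra. }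
  lra.
Qed.

End Cauchy.

Theorem proposition3p2 :
  forall (b tau K : R) (q f : R -> C) (alpha : C)
         (F G : R -> C) (u : R -> R -> C),
  0 < b -> 0 < tau -> 0 < K ->
  continuous_on (U := C_UniformSpace) (fun x : R => -b <= x <= b) q ->
  nonvanishing_solution b q f ->
  f 0 = 1%C ->
  CDerive f 0 = alpha ->
  Holmgren b tau K 0 F ->
  Holmgren b tau K 0 G ->
  classical_Cauchy_solution b tau q F G u ->
  forall r : R, 0 < r < b ->
  converges_absolutely_on (fun x t => Rabs x <= r /\ Rabs t < tau)
    (series_term f alpha F G) /\
  converges_uniformly_on (fun x t => Rabs x <= r /\ Rabs t < tau)
    (series_term f alpha F G) u.
Proof.
  intros b tau K q f alpha F G u Hb Htau HK Hq Hf Hf0 Halpha HF HG Hu r Hr.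
  destruct (continuous_bounded (fun s => Cmod (q s)) (-r) r) as [Q [HQ HQ']].
  (* Continuity of [q] is given relative to the closed interval. Points with [|s| <= r < b] are
     interior, so the [within] filter can be replaced by the full neighbourhood filter. *)
  { intros s Hs. apply continuous_Cmod_comp. intros P HP.
    assert (Hs' : -b <= s <= b) by lra.
    assert (A := Hq s Hs' P HP). unfold filtermap, within in A |- *.
    assert (B : locally s (fun x => -b <= x <= b)).
    { apply (locally_open_interval _ (-b) b); [lra|]. intros; lra. }
    generalize (filter_and _ _ A B). apply filter_imp. intros y [H1 H2]; auto. }
  (* One exponent meeting all three requirements: [c >= 1], [c >= Q] and [c >= |alpha|]. *)
  set (c := 1 + Q + Cmod alpha). assert (Ha := Cmod_ge_0 alpha).
  assert (Hfp : forall k s, -r <= s <= r -> Cmod (formal_power f k s) <= Rabs s ^ k * exp (c * Rabs s)).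
  { intros k. apply (formal_power_bound b q f Hf Hf0 c Q r); auto; unfold c; try lra.
    rewrite Halpha; lra. }
  set (rho := (r / b) ^ 2).
  assert (Hrho : 0 <= rho < 1).
  { assert (0 < r / b < 1).
    { split; [apply Rdiv_lt_0_compat; lra | apply Rlt_div_l; lra]. }
    unfold rho; cbn; nra. }
  set (A := K * exp (c * r) * (1 + Cmod alpha * r + r)).
  assert (HA : 0 <= A).
  { unfold A. apply Rmult_le_pos; [apply Rmult_le_pos; [lra | left; apply exp_pos]|].
    assert (0 <= Cmod alpha * r) by (apply Rmult_le_pos; lra). lra. }
  assert (Hterm : forall j x t, Rabs x <= r -> Rabs t < tau ->
     Cmod (series_term f alpha F G j x t) <= A * rho ^ j).
  { intros j x t Hx Ht. eapply series_term_bound; try eassumption. unfold c; lra. }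
  split.
  - intros x t [Hx Ht].
    apply (ex_series_le (K := R_AbsRing) (V := R_CompleteNormedModule) _ (fun j => A * rho ^ j)).
    + intros j. change (Rabs (Cmod (series_term f alpha F G j x t)) <= A * rho ^ j).
      rewrite Rabs_pos_eq by apply Cmod_ge_0. auto.
    + apply (ex_series_scal (K := R_AbsRing) (V := R_NormedModule) A). exists (/ (1 - rho)). apply is_series_geom.
      rewrite Rabs_pos_eq; lra.
  - intros eps Heps.
    (* The closeness estimate loses a factor [4]; a fifth keeps the final inequality strict. *)
    set (e := eps / 5). assert (He : 0 < e) by (unfold e; lra).
    (* Chosen so that [A rho^(S n) / (1 - rho) <= e]; the exponent is [S n] because [sum_n] up to
       [n] has [n + 1] terms. *)
    destruct (pow_lt_1_zero rho) with (y := e * (1 - rho) / (A + 1)) as [N HN].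
    { rewrite Rabs_pos_eq; lra. }
    { apply Rdiv_lt_0_compat; [apply Rmult_lt_0_compat|]; lra. }
    exists N. intros n x t Hn [Hx Ht].
    rewrite sum_n_csum. rewrite <- Cmod_opp.
    replace (- (csum (fun j => series_term f alpha F G j x t) (S n) - u x t))%C
      with (u x t - csum (fun j => series_term f alpha F G j x t) (S n))%C by ring.
    apply Rle_lt_trans with (4 * e); [|unfold e; lra].
    apply (partial_sum_close b tau K q f alpha F G u Hb Hf Hf0 Halpha HF HG Hu c Q r A rho e (S n));
      auto; try (unfold c; lra).
    assert (L := HN (S n) ltac:(lia)). rewrite Rabs_pos_eq in L by (apply pow_le; lra).
    apply Rle_div_l; [lra|].
    apply Rle_trans with (A * (e * (1 - rho) / (A + 1))); [apply Rmult_le_compat_l; lra|].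
    assert (0 <= e * (1 - rho)) by (apply Rmult_le_pos; lra).
    apply Rmult_le_reg_r with (A + 1); [lra|].
    replace (A * (e * (1 - rho) / (A + 1)) * (A + 1)) with (A * (e * (1 - rho))) by (field; lra). nra.
Qed.
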